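(* Let $A$ be an associative commutative unital $\mathbb{C}$-algebra of finite dimension $n=\dim_{\mathbb{C}}A$. The following conditions are each equivalent to $A$ being Gorenstein: (1) the characteristic sequence of $A$ is symmetric; (2) $c^A_{0,\dots,0,n-1}=1$; (3) $c^A_{0,\dots,0,n-1}\neq 0$.
   Context: Algebras are associative, commutative, unital and finite-dimensional over $\mathbb{C}$. An algebra $A$ is Gorenstein if there is a linear functional $\lambda\colon A\to\mathbb{C}$ such that $(a,b)\mapsto\lambda(ab)$ is a perfect pairing on $A$. Characteristic numbers of subspaces. Let $V$ be a complex vector space of dimension $n$. The variety of complete quadrics $\mathcal{CQ}(V)$ is the closure of the image of the rational map $\Phi\colon\mathbb{P}(S^2V)\dashrightarrow\prod_{i=1}^{n-1}\mathbb{P}(S^2(\bigwedge^iV))$, $[\varphi]\mapsto([\bigwedge^i\varphi])_i$, where $\varphi\in S^2V$ is viewed as a symmetric map $V^*\to V$ (in coordinates, $\bigwedge^i\varphi$ is the matrix of $i\times i$ minors of a symmetric matrix). Let $L_i$ be the pullback to $\mathcal{CQ}(V)$ of the hyperplane class of the $i$-th factor. For a linear subspace $L\subset S^2V$ of dimension $d+1$ containing a matrix of rank at least $n-1$, let $X_L$ be the closure of the image under $\Phi$ of the open set of matrices of rank at least $n-1$ in $\mathbb{P}(L)$; $\dim X_L=d$. For non-negative integers $b_1,\dots,b_{n-1}$ with sum $d$, the characteristic number is $c^L_{b_1,\dots,b_{n-1}}=[X_L]\cdot L_1^{b_1}\cdots L_{n-1}^{b_{n-1}}\in\mathbb{Z}$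 (intersection in the Chow ring of $\mathcal{CQ}(V)$), i.e. the number of points of the intersection of $X_L$ with $b_i$ general hyperplanes pulled back from the $i$-th factor, $i=1,\dots,n-1$. If the maximal rank of matrices in $L$ is $k<n-1$, the numbers indexed by $(b_1,\dots,b_k,0,\dots,0)$ are defined in the same way using the truncation of $\Phi$ to the first $k$ factors, and all other characteristic numbers are declared to be $0$. The characteristic sequence of $L$ is the sequence of numbers indexed by $(d-i,0,\dots,0,i)$, i.e. $[X_L]\cdot L_1^{d-i}L_{n-1}^{i}$, for $i=0,1,\dots,d$ (for $n=2$ both exponents refer to the same class $L_1$; for $n=1$ the only characteristic number is the empty-indexed one, equal to $1$ for $L\ne 0$). The sequence is symmetric if its $i$-th and $(d-i)$-th terms agree for all $i$. Characteristic numbers of algebras. For an algebra $A$ of dimension $n$, let $L^A\subset S^2A^*$ be the $n$-dimensional space of symmetric bilinear forms $(a,b)\mapsto\lambda(ab)$, $\lambda\in A^*$. The characteristic numbers $c^A_{b_1,\dots,b_{n-1}}$ (with $\sum b_i=n-1$) and the characteristic sequence of $A$ are those of $L^A$ (with $V=A^*$). *)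

(* Defs.v *)
From HB Require Import structures.
From mathcomp Require Import all_boot all_order all_algebra all_field.
From mathcomp Require Import boolp classical_sets.
From mathcomp Require Import mpoly.

Set Implicit Arguments.
Unset Strict Implicit.
Unset Printing Implicit Defensive.

Import GRing.Theory.
Local Open Scope ring_scope.

(* The basis e_{t_1} /\ ... /\ e_{t_i}, t_1 < ... < t_i, of the i-th exterior
   power of an n-dimensional space. *)
Definition wedge_index (n i : nat) : finType :=
  {t : i.-tuple 'I_n | sorted ltn (map val t)}.

Section CompleteQuadrics.
Variable F : fieldType.

(* S^2 of a space with a chosen basis is encoded by symmetric matrices. *)

Definition compound (n i : nat) (M : 'M[F]_n) : 'M[F]_#|wedge_index n i| :=
  \matrix_(s, t) \det (mxsub (tnth (val (enum_val s)))
                             (tnth (val (enum_val t))) M).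

Section Ambient.
Variables n k : nat.

(* Homogeneous coordinates on the product over i = 1, ..., k of the spaces
   P(S^2(/\^i V)), dim V = n.  The ordinal i stands for the factor i.+1. *)
Definition factor_family :=
  forall i : 'I_k, 'M[F]_#|wedge_index n i.+1|.

Definition is_point (x : factor_family) : Prop :=
  forall i, (x i)^T = x i /\ x i != 0.

Definition same_point (x y : factor_family) : Prop :=
  forall i, exists2 c : F, c != 0 & x i = c *: y i.

Definition has_card_points (S : factor_family -> Prop) (N : nat) : Prop :=
  exists s : 'I_N -> factor_family,
    [/\ forall a, S (s a),
        forall a b, same_point (s a) (s b) -> a = b
      & forall x, S x -> exists a, same_point x (s a)].

Definition coord : finType :=
  {i : 'I_k & 'I_#|wedge_index n i.+1| * 'I_#|wedge_index n i.+1|}%type.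

Definition coord_poly := {mpoly F[#|coord|]}.

Definition poly_at (p : coord_poly) (x : factor_family) : F :=
  p.@[fun v => let c := enum_val v in
               x (tag c) (tagged c).1 (tagged c).2].

Definition multihomogeneous (p : coord_poly) : Prop :=
  exists e : 'I_k -> nat, forall m, m \in msupp p ->
    forall i, (\sum_(v | tag (enum_val v) == i) m v)%N = e i.

(* Zariski closure, in the product of projective spaces, of the set of points
   having a representative in S.  For S in the complete quadrics, which form a
   closed subset of the product, this is also the closure there. *)
Definition zariski_closure (S : factor_family -> Prop) (x : factor_family) :=
  is_point x /\
  forall p, multihomogeneous p ->
    (forall y, S y -> poly_at p y = 0) -> poly_at p x = 0.

Section Hyperplanes.
Variable b : 'I_k -> nat.

(* b i hyperplanes in the i-th factor; a symmetric matrix h gives the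
   hyperplane tr (h x) = 0. *)
Definition hyperplanes :=
  forall i : 'I_k, 'I_(b i) -> 'M[F]_#|wedge_index n i.+1|.

Definition hyp_coord : finType :=
  {i : 'I_k & 'I_(b i) *
     ('I_#|wedge_index n i.+1| * 'I_#|wedge_index n i.+1|)}%type.

Definition hyp_poly_at (g : {mpoly F[#|hyp_coord|]}) (h : hyperplanes) : F :=
  g.@[fun v => let c := enum_val v in
               h (tag c) (tagged c).1 (tagged c).2.1 (tagged c).2.2].

Definition sym_hyperplanes (h : hyperplanes) : Prop :=
  forall i j, (h i j)^T = h i j.

(* P holds on a nonempty Zariski-open set of families of hyperplanes. *)
Definition for_general_hyperplanes (P : hyperplanes -> Prop) : Prop :=
  exists g,
    (exists2 h, sym_hyperplanes h & hyp_poly_at g h != 0) /\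
    (forall h, sym_hyperplanes h -> hyp_poly_at g h != 0 -> P h).

Definition on_hyperplanes (h : hyperplanes) (x : factor_family) : Prop :=
  forall i j, \tr (h i j *m x i) = 0.

(* The intersection number of X with b i hyperplane classes from the i-th
   factor, when X is closed of dimension \sum_i b i, counted as the number of
   points in which X meets general hyperplanes: the linear systems are base
   point free, so in characteristic 0 a general intersection is reduced. *)
Definition is_general_count (X : factor_family -> Prop) (N : nat) : Prop :=
  for_general_hyperplanes
    (fun h => has_card_points (fun x => X x /\ on_hyperplanes h x) N).

(* For infinite F at most one N satisfies is_general_count X N. *)
Definition general_count (X : factor_family -> Prop) : nat :=
  xget 0%N [set N | is_general_count X N]%classic.

End Hyperplanes.
End Ambient.

Section Subspaces.
Variable n : nat.
Implicit Type L : {vspace 'M[F]_n}.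

Definition max_rank L : nat :=
  \max_(r < n.+1 | `[< exists2 M, M \in L & \rank M = r >]) r.

(* The image of P(L) under the first k components of Phi, on the open set of
   matrices of rank at least k.  For k = 0 the condition M != 0 is not implied
   by the rank condition. *)
Definition Phi_image k L (y : factor_family n k) : Prop :=
  exists M, [/\ M \in L, M != 0, (k <= \rank M)%N
              & forall i : 'I_k, y i = compound i.+1 M].

Definition X_ k L : factor_family n k -> Prop :=
  zariski_closure (@Phi_image k L).

(* Number of factors used: all n.-1 of them if L contains a matrix of rank at
   least n.-1, and the maximal rank of L otherwise. *)
Definition nb_factors L : nat := minn (max_rank L) n.-1.

(* b j is the exponent of L_{j+1}; meaningful when
   (\sum_j b j).+1 = \dim L. *)
Definition char_number L (b : 'I_n.-1 -> nat) : nat :=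
  if [forall j : 'I_n.-1, (nb_factors L <= j)%N ==> (b j == 0%N)] then
    general_count
      (fun i : 'I_(nb_factors L) => b (widen_ord (geq_minr _ _) i))
      (@X_ (nb_factors L) L)
  else 0%N.

(* (p, 0, ..., 0, q), that is L_1^p L_{n-1}^q; for n = 2 the two classes
   coincide and the exponents add up. *)
Definition end_exponents (p q : nat) (j : 'I_n.-1) : nat :=
  ((if j == 0 :> nat then p else 0) + (if j.+2 == n then q else 0))%N.

Definition char_seq L (i : nat) : nat :=
  char_number L (end_exponents ((\dim L).-1 - i) i).

Definition symmetric_char_seq L : Prop :=
  forall i, (i <= (\dim L).-1)%N ->
    char_seq L i = char_seq L ((\dim L).-1 - i).

End Subspaces.
End CompleteQuadrics.

Section Algebras.
Variables (F : fieldType) (A : falgType F).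

Definition perfect_pairing (B : A -> A -> F) : Prop :=
  (forall f : 'Hom(A, F^o), exists! a, forall b, B a b = f b) /\
  (forall f : 'Hom(A, F^o), exists! b, forall a, B a b = f a).

Definition Gorenstein : Prop :=
  exists l : 'Hom(A, F^o), perfect_pairing (fun a b => l (a * b)).

Section Coordinates.
Variables (n : nat) (e : n.-tuple A).

(* The matrix of (a, b) |-> l (a * b) in the basis e of A, i.e. this form as an
   element of S^2 A^* in the dual basis. *)
Definition form_mx (l : 'Hom(A, F^o)) : 'M[F]_n :=
  \matrix_(i, j) l (tnth e i * tnth e j).

Fact form_mx_is_linear : linear form_mx.
Proof.
move=> c l l'; apply/matrixP => i j.
by rewrite !mxE lfunE /= lfunE.
Qed.

HB.instance Definition _ :=
  GRing.isLinear.Build F 'Hom(A, F^o) 'M[F]_n *:%R form_mx form_mx_is_linear.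

Definition form_space : {vspace 'M[F]_n} := limg (linfun form_mx).

Lemma form_spaceP M :
  reflect (exists l, M = form_mx l) (M \in form_space).
Proof.
apply: (iffP memv_imgP) => [[l _ ->]|[l ->]]; exists l; rewrite ?memvf //.
  by rewrite lfunE.
by rewrite lfunE.
Qed.

End Coordinates.
End Algebras.

(* Main.v *)
Require Import Defs.
From mathcomp Require Import all_boot all_order all_fingroup all_algebra all_field.
From mathcomp Require Import boolp.
From mathcomp Require classical_sets.
From mathcomp Require Import mpoly.
From mathcomp Require Import reals complex.
From mathcomp Require Import ring zify.
Import Order.TTheory GRing.Theory Num.Theory.

(** Write L for the space of forms of A.

    The class L_1^{n-1} always has degree 1 on X_L: general hyperplanes in the
    first factor cut P(L) in one general point, and over it the graph of Phi has
    a single point.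

    If A is Gorenstein, L contains an invertible G and is stable under
    M |-> G M^-1 G. By Jacobi's identity on complementary minors and Cauchy-Binet
    this inversion is given, on the product of the P(S^2(/\^i V)), by linear
    isomorphisms between the i-th and the (n-i)-th factors. So X_L has a symmetry
    exchanging L_i and L_(n-i), and the characteristic sequence is symmetric.

    If A is not Gorenstein, det = 0 on L, so adj M * N * adj M = 0 for M, N in L.
    Hence the last coordinate of a point of X_L is c v^T v with v a square-zero
    element of A. Such v lie in the hyperplane on which the regular trace vanishes,
    where n-1 general quadrics have no common zero; so L_(n-1)^(n-1) has degree
    0. *)

Set Implicit Arguments.
Unset Strict Implicit.
Unset Printing Implicit Defensive.

Local Open Scope ring_scope.

(** * Compound matrices *)

Section WedgeIndex.
Variable n : nat.

(** A point of [X_ L] is known only through the multihomogeneous equations of the image. Instead of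
    dimension theory, each property of the closure is such an equation, or is transported by a
    substitution linear in every factor. Likewise, generality of hyperplanes is witnessed by an
    explicit nonzero polynomial: a determinant times a minor for the first class, a resultant of
    quadrics for the last.

    Stability under M |-> G M^-1 G comes from the multiplication. If M is the form of an invertible
    l, then G is the form of b |-> l(c b) for some c, so G M^-1 is multiplication by c and G M^-1 G
    is the form of b |-> l(c^2 b).

    The regular trace kills square-zero elements, while its value n at 1 is nonzero in
    characteristic 0. Passing to its kernel is what makes the count vanish: n-1 quadrics in n
    variables always have a nontrivial common zero over an algebraically closed field, but n-1
    general quadrics in n-1 variables have none.

    The equivalences then follow from the two ends of the sequence: the first term is 1, the last is
    1 by symmetry or 0. *)

Definition wedge_set i (s : wedge_index n i) : {set 'I_n} := [set x in val s].

Lemma wedge_uniq i (s : wedge_index n i) : uniq (val s).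
Proof.
rewrite -(map_inj_uniq val_inj).
exact: (sorted_uniq ltn_trans ltnn (valP s)).
Qed.

Lemma tnth_wedge_inj i (s : wedge_index n i) : injective (tnth (val s)).
Proof. exact/tuple_uniqP/wedge_uniq. Qed.

Lemma card_wedge_set i (s : wedge_index n i) : #|wedge_set s| = i.
Proof. by rewrite cardsE (card_uniqP (wedge_uniq s)) size_tuple. Qed.

Lemma wedge_set_inj i : injective (@wedge_set i).
Proof.
move=> s t /setP st; do 2!apply: val_inj; apply: (inj_map val_inj).
apply: (irr_sorted_eq ltn_trans ltnn (valP s) (valP t)) => k.
apply/mapP/mapP => -[x xs ->]; exists x => //; move: (st x); rewrite !inE.
  by rewrite xs.
by rewrite xs => ->.
Qed.

Lemma sorted_enum_set (A : {set 'I_n}) : sorted ltn (map val (enum A)).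
Proof.
rewrite sorted_map; apply: sorted_filter; first by move=> y x z; apply: ltn_trans.
by rewrite -enumT -sorted_map val_enum_ord iota_ltn_sorted.
Qed.

Lemma wedge_set_surj i (A : {set 'I_n}) :
  #|A| = i -> exists s : wedge_index n i, wedge_set s = A.
Proof.
move=> cA; have sz : size (enum A) == i by rewrite -cardE cA.
exists (exist _ (Tuple sz) (sorted_enum_set A)).
by apply/setP=> x; rewrite inE /= mem_enum.
Qed.

Lemma wedge_of_inj i (f : 'I_i -> 'I_n) : injective f ->
  exists (s : wedge_index n i) (sigma : 'S_i),
    forall j, f j = tnth (val s) (sigma j).
Proof.
move=> f_inj.
have [|s sE] := @wedge_set_surj i [set f j | j : 'I_i].
  by rewrite card_imset // card_ord.
have /fin_all_exists [g gE] j : exists k, f j = tnth (val s) k.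
  apply/tnthP; have : f j \in wedge_set s by rewrite sE imset_f.
  by rewrite inE.
have g_inj : injective g by move=> j k gjk; apply: f_inj; rewrite !gE gjk.
by exists s, (perm g_inj) => j; rewrite permE.
Qed.

Lemma wedge_set_perm i (s : wedge_index n i) (sigma : 'S_i) :
  wedge_set s = [set tnth (val s) (sigma j) | j : 'I_i].
Proof.
apply/setP=> x; rewrite inE; apply/tnthP/imsetP => [[k ->]|[j _ ->]].
  by exists (sigma^-1%g k); rewrite ?permKV.
by exists (sigma j).
Qed.

End WedgeIndex.

(** * The Cauchy-Binet formula *)

Section CauchyBinet.
Variable F : fieldType.

Lemma det_mulmx_ffun i n (A : 'M[F]_(i, n)) (B : 'M[F]_(n, i)) :
  \det (A *m B) =
  \sum_(f : {ffun 'I_i -> 'I_n}) (\prod_j A j (f j)) * \det (rowsub f B).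
Proof.
transitivity (\sum_(s : 'S_i) \sum_(f : {ffun 'I_i -> 'I_n})
    (-1) ^+ s * \prod_j (A j (f j) * B (f j) (s j))).
  apply: eq_bigr => s _; rewrite -big_distrr /=; congr (_ * _).
  rewrite -(bigA_distr_bigA (fun j k => A j k * B k (s j))).
  by apply: eq_bigr => j _; rewrite mxE.
rewrite exchange_big; apply: eq_bigr => f _; rewrite big_distrr /=.
apply: eq_bigr => s _; rewrite big_split /= mulrCA; congr (_ * (_ * _)).
by apply: eq_bigr => j _; rewrite mxE.
Qed.

(** In the expansion over all maps [f], a non-injective [f] repeats a row of [B] and contributes 0.
    An injective one is uniquely a sorted selection followed by a permutation, and the sum over the
    permutations rebuilds the minor of [A]. *)
Theorem Cauchy_Binet i n (A : 'M[F]_(i, n)) (B : 'M[F]_(n, i)) :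
  \det (A *m B) = \sum_(s : wedge_index n i)
    \det (colsub (tnth (val s)) A) * \det (rowsub (tnth (val s)) B).
Proof.
pose h (p : wedge_index n i * 'S_i) : {ffun 'I_i -> 'I_n} :=
  [ffun j => tnth (val p.1) (p.2 j)].
have h_inj : injective h.
  move=> [s p] [t q] /ffunP e.
  have e' j : tnth (val s) (p j) = tnth (val t) (q j).
    by have := e j; rewrite !ffunE.
  have est : s = t.
    apply: wedge_set_inj; rewrite (wedge_set_perm s p) (wedge_set_perm t q).
    exact: eq_imset.
  subst t; congr (_, _); apply/permP=> j.
  exact: tnth_wedge_inj (e' j).
rewrite det_mulmx_ffun (bigID (fun f => f \in [set h p | p in setT])) /=.
rewrite [X in _ + X]big1 ?addr0 => [|f]; last first.
  move=> nf; have [/injectiveP f_inj|/injectivePn [j [k jk fjk]]] :=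
    boolP (injectiveb f); last first.
    rewrite (determinant_alternate jk) ?mulr0 // => l.
    by rewrite !mxE fjk.
  case/imsetP: nf; have [s [p sp]] := wedge_of_inj f_inj.
  by exists (s, p); rewrite ?inE //; apply/ffunP=> j; rewrite ffunE sp.
rewrite big_imset /=; last by move=> p q _ _; apply: h_inj.
rewrite (eq_bigl xpredT) => [|p]; last by rewrite inE.
rewrite -(pair_bigA _ (fun s (p : 'S_i) =>
  \prod_j A j (h (s, p) j) * \det (rowsub (h (s, p)) B))) /=.
apply: eq_bigr => s _; rewrite [\det (colsub _ _)]/determinant big_distrl /=.
apply: eq_bigr => p _.
have -> : rowsub (h (s, p)) B = row_perm p (rowsub (tnth (val s)) B).
  by apply/matrixP=> j k; rewrite !mxE ffunE.
rewrite row_permE det_mulmx det_perm mulrCA mulrA; congr (_ * _ * _).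
by apply: eq_bigr => j _; rewrite !mxE ffunE.
Qed.

End CauchyBinet.

Section Compound.
Variable F : fieldType.
Implicit Types n i : nat.

Lemma mxsub_selection m n p q (f : 'I_p -> 'I_m) (g : 'I_q -> 'I_n)
    (A : 'M[F]_(m, n)) : mxsub f g A = rowsub f 1%:M *m A *m colsub g 1%:M.
Proof.
by rewrite mulmx_colsub mulmx1 -rowsubE -mxsubcr.
Qed.

Lemma compoundM n i (M N : 'M[F]_n) :
  compound i (M *m N) = compound i M *m compound i N.
Proof.
apply/matrixP=> s t; rewrite !mxE.
rewrite mxsub_mul Cauchy_Binet (reindex_onto enum_val enum_rank) /=; last first.
  by move=> r _; rewrite enum_rankK.
apply: eq_big => [r|r _]; first by rewrite enum_valK eqxx.
by rewrite !mxE -mxsubcr -mxsubrc.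
Qed.

Lemma compoundZ n i (c : F) (M : 'M[F]_n) :
  compound i (c *: M) = c ^+ i *: compound i M.
Proof.
apply/matrixP=> s t; rewrite !mxE -detZ; congr (\det _).
by apply/matrixP=> a b; rewrite !mxE.
Qed.

Lemma trmx_compound n i (M : 'M[F]_n) : (compound i M)^T = compound i M^T.
Proof.
apply/matrixP=> s t; rewrite !mxE -det_tr; congr (\det _).
by apply/matrixP=> a b; rewrite !mxE.
Qed.

Lemma mxsub_scalar1 m n (f : 'I_m -> 'I_n) :
  injective f -> mxsub f f 1%:M = 1%:M :> 'M[F]_m.
Proof.
by move=> f_inj; apply/matrixP=> j k; rewrite !mxE (inj_eq f_inj).
Qed.

Lemma compound1 n i : compound i 1%:M = 1%:M :> 'M[F]_#|wedge_index n i|.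
Proof.
apply/matrixP=> s t; rewrite !mxE.
have [->|nst] := eqVneq s t.
  by rewrite mxsub_scalar1 ?det1 //; apply: tnth_wedge_inj.
(* Distinct index sets of equal size: some index of the first is missing from the second, and gives
   a zero row. *)
have [j nj] : exists j, tnth (val (enum_val s)) j \notin val (enum_val t).
  apply/existsP; apply: contraR nst => /existsPn sub.
  rewrite -(inj_eq enum_val_inj) -(inj_eq (@wedge_set_inj _ _)).
  rewrite eqEcard !card_wedge_set leqnn andbT.
  apply/fintype.subsetP=> x; rewrite !inE => /tnthP[j ->].
  by have := sub j; rewrite negbK.
rewrite (expand_det_row _ j) big1 // => k _; rewrite !mxE.
by case: eqP nj => [->|]; rewrite ?mem_tnth // mul0r.
Qed.

Lemma leq_rank_mxsub m n p q (f : 'I_p -> 'I_m) (g : 'I_q -> 'I_n)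
    (A : 'M[F]_(m, n)) : (\rank (mxsub f g A) <= \rank A)%N.
Proof.
by rewrite mxsub_selection (leq_trans (mxrankM_maxl _ _)) // mxrankM_maxr.
Qed.

Lemma leq_rank_minor n i (f g : 'I_i -> 'I_n) (M : 'M[F]_n) :
  \det (mxsub f g M) != 0 -> (i <= \rank M)%N.
Proof.
rewrite -unitfE -[_ \is a _]unitmxE => /mxrank_unit {1}<-.
exact: leq_rank_mxsub.
Qed.

(** By multiplicativity and Gaussian elimination, a vanishing compound of [M] would force that of
    [pid_mx (\rank M)] to vanish, but there the principal minor on the first [i] indices is 1. *)
Lemma compound_neq0 n i (M : 'M[F]_n) : (i <= \rank M)%N -> compound i M != 0.
Proof.
move=> le_i; have le_in := leq_trans le_i (rank_leq_row M).
apply: contraTneq isT => M0.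
have : compound i (pid_mx (\rank M) : 'M[F]_n) = 0.
  have -> : pid_mx (\rank M) =
     invmx (col_ebase M) *m M *m invmx (row_ebase M) :> 'M[F]_n.
    have := congr1 (fun X => invmx (col_ebase M) *m X *m invmx (row_ebase M))
      (mulmx_ebase M).
    move=> <-; rewrite !mulmxA mulVmx ?col_ebase_unit // mul1mx.
    by rewrite -mulmxA mulmxV ?row_ebase_unit // mulmx1.
  by rewrite !compoundM M0 mulmx0 mul0mx.
have [|s [p sp]] := @wedge_of_inj n i (widen_ord le_in).
  by move=> x y /(congr1 val)/= /val_inj.
move=> /matrixP /(_ (enum_rank s) (enum_rank s)); rewrite !mxE !enum_rankK.
have -> : mxsub (tnth (val s)) (tnth (val s)) (pid_mx (\rank M)) =
    1%:M :> 'M[F]_i; last by rewrite det1 => /eqP; rewrite oner_eq0.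
apply/matrixP=> j k; rewrite !mxE -(permKV p j) -!sp /=.
rewrite (leq_trans (ltn_ord _) le_i) andbT -[k in LHS](permKV p).
by rewrite -sp /= (inj_eq val_inj) !permKV (inj_eq perm_inj).
Qed.

End Compound.

(** * Complementary minors and signed permutations of coordinates *)

Section ComplementaryMinors.
Variable F : fieldType.

(** [Q] is a signed permutation matrix, hence orthogonal. It has a rectangular type because the
    sizes will be cardinalities of two index types, equal only propositionally. *)
Lemma signed_selection p q (f : 'I_p -> 'I_q) (eps : 'I_p -> F) :
  p = q -> injective f -> (forall i, eps i ^+ 2 = 1) ->
  exists Q : 'M[F]_(p, q), [/\ Q *m Q^T = 1%:M, Q^T *m Q = 1%:M &
    forall C i j, (Q *m C *m Q^T) i j = eps i * eps j * C (f i) (f j)].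
Proof.
move=> pq f_inj eps2; pose D := diag_mx (\row_i eps i).
have QE C : D *m rowsub f 1%:M *m C *m (D *m rowsub f 1%:M)^T =
    D *m mxsub f f C *m D.
  by rewrite trmx_mul tr_diag_mx trmx_mxsub trmx1 !mulmxA -(mulmxA D) -(mulmxA D)
    -mxsub_selection.
have QQ : D *m rowsub f 1%:M *m (D *m rowsub f 1%:M)^T = 1%:M.
  have := QE 1%:M; rewrite mulmx1 => ->; rewrite mxsub_scalar1 // mulmx1 mulmx_diag.
  apply/matrixP=> i j; rewrite !mxE; case: eqP => // ->.
  by rewrite -expr2 eps2.
exists (D *m rowsub f 1%:M); split=> //.
  by move: (D *m _) QQ; case: q / pq {f f_inj D QE} => Q /mulmx1C.
by move=> C i j; rewrite QE mul_diag_mx mul_mx_diag !mxE mulrAC.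
Qed.

Variable n : nat.

(** Lists [s] and then its complement, both increasingly. The list has [n] entries, so the default
    of [nth] is never returned. *)
Definition shuffle a (s : wedge_index n a) (j : 'I_n) : 'I_n :=
  nth j (val s ++ enum (~: wedge_set s)) j.

(** The sign of the shuffle, taken as the determinant of its permutation matrix so that it comes
    directly out of [det_mulmx]. *)
Definition shuffle_sign a (s : wedge_index n a) : F :=
  \det (rowsub (shuffle s) 1%:M : 'M[F]_n).

Lemma enum_wedge_set a (s : wedge_index n a) : enum (wedge_set s) = val s.
Proof.
apply: (inj_map val_inj); apply: (irr_sorted_eq ltn_trans ltnn).
- exact: sorted_enum_set.
- exact: valP s.
by move=> k; apply/mapP/mapP => -[x xs ->]; exists x => //;
  rewrite ?mem_enum !inE in xs *.
Qed.

Lemma shuffle_inj a (s : wedge_index n a) : injective (shuffle s).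
Proof.
have sz : size (val s ++ enum (~: wedge_set s)) = n.
  by rewrite size_cat -enum_wedge_set -!cardE cardsC card_ord.
have un : uniq (val s ++ enum (~: wedge_set s)).
  rewrite cat_uniq wedge_uniq enum_uniq andbT /=; apply/hasPn=> x.
  by rewrite mem_enum !inE.
move=> i j; rewrite /shuffle (set_nth_default j) ?sz // => /eqP.
by rewrite nth_uniq ?sz // => /eqP/val_inj.
Qed.

Lemma shuffle_sign_sqr a (s : wedge_index n a) : shuffle_sign s ^+ 2 = 1.
Proof.
rewrite expr2 /shuffle_sign -[X in _ * X]det_tr -det_mulmx.
rewrite trmx_mxsub trmx1 -[X in X *m _]mulmx1 -mxsub_selection.
by rewrite mxsub_scalar1 ?det1 //; apply: shuffle_inj.
Qed.

Lemma det_shuffle a (s t : wedge_index n a) (M : 'M[F]_n) :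
  \det (mxsub (shuffle s) (shuffle t) M) =
  shuffle_sign s * \det M * shuffle_sign t.
Proof.
rewrite mxsub_selection !det_mulmx; congr (_ * _).
by rewrite -det_tr trmx_mxsub trmx1.
Qed.

End ComplementaryMinors.

(** [K] joins the first columns of [invmx M] to the last columns of the identity, so [M *m K] joins
    the first columns of the identity to the last columns of [M]. Both determinants are block
    triangular. *)
Lemma det_complementary_blocks (F : fieldType) a b (M : 'M[F]_(a + b)) :
  M \in unitmx -> \det M * \det (ulsubmx (invmx M)) = \det (drsubmx M).
Proof.
move=> uM; pose K : 'M[F]_(a + b) :=
  block_mx (ulsubmx (invmx M)) 0 (dlsubmx (invmx M)) 1%:M.
have -> : \det (ulsubmx (invmx M)) = \det K by rewrite det_lblock det1 mulr1.
have -> : \det (drsubmx M) = \det (block_mx 1%:M (ursubmx M) 0 (drsubmx M)).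
  by rewrite det_ublock det1 mul1r.
rewrite -det_mulmx; congr (\det _).
have := mulmxV uM; rewrite -{1}(submxK M) -{1}(submxK (invmx M)) mulmx_block.
rewrite scalar_mx_block => /eq_block_mx[ul _ dl _].
rewrite -{1}(submxK M) mulmx_block ul dl.
by rewrite !mulmx0 !mulmx1 !add0r.
Qed.

Section CompoundCoordinates.
Variable F : fieldType.

Lemma shuffle_lshift a b (s : wedge_index (a + b) a) (j : 'I_a) :
  shuffle s (lshift b j) = tnth (val s) j.
Proof. by rewrite /shuffle nth_cat size_tuple /= ltn_ord (tnth_nth (lshift b j)). Qed.

Lemma shuffle_rshift a b (s : wedge_index (a + b) a) (s' : wedge_index (a + b) b)
    (j : 'I_b) :
  wedge_set s' = ~: wedge_set s -> shuffle s (rshift a j) = tnth (val s') j.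
Proof.
move=> ss'; rewrite /shuffle nth_cat size_tuple /= ltnNge leq_addr /= addKn.
by rewrite -ss' enum_wedge_set (tnth_nth (rshift a j)).
Qed.

(** Permuting rows by [shuffle s] and columns by [shuffle t] moves the two minors into opposite
    diagonal blocks, which reduces the claim to [det_complementary_blocks]; the signs are the
    determinants of the two shuffles. *)
Theorem Jacobi_complementary_minors a b (s t : wedge_index (a + b) a)
    (s' t' : wedge_index (a + b) b) (M : 'M[F]_(a + b)) :
  wedge_set s' = ~: wedge_set s -> wedge_set t' = ~: wedge_set t ->
  M \in unitmx ->
  \det M * \det (mxsub (tnth (val t)) (tnth (val s)) (invmx M)) =
  shuffle_sign F s * shuffle_sign F t * \det (mxsub (tnth (val s')) (tnth (val t')) M).
Proof.
move=> ss' tt' uM.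
pose N := mxsub (shuffle s) (shuffle t) M.
have uN : N \in unitmx.
  move: (uM); rewrite !unitmxE det_shuffle !unitrM => -> /=; rewrite !unitfE.
  by rewrite andbT -2!(sqrf_eq0 (shuffle_sign _ _)) !shuffle_sign_sqr oner_eq0.
have invN : invmx N = mxsub (shuffle t) (shuffle s) (invmx M).
  rewrite -[LHS]mulmx1; apply: (canLR (mulKmx uN)); symmetry.
  rewrite [N]mxsub_selection [mxsub _ _ (invmx M)]mxsub_selection.
  have tt : colsub (shuffle t) 1%:M *m rowsub (shuffle t) 1%:M = 1%:M :> 'M[F]_(a + b).
    apply: mulmx1C; rewrite -[X in X *m _]mulmx1 -mxsub_selection.
    by rewrite mxsub_scalar1 //; apply: shuffle_inj.
  rewrite !mulmxA -(mulmxA _ (colsub _ _)) tt mulmx1 mulmxK //.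
  rewrite -[X in X *m _]mulmx1 -mxsub_selection.
  by rewrite mxsub_scalar1 //; apply: shuffle_inj.
have := det_complementary_blocks uN; rewrite invN.
have -> : ulsubmx (mxsub (shuffle t) (shuffle s) (invmx M)) =
    mxsub (tnth (val t)) (tnth (val s)) (invmx M).
  by apply/matrixP=> i j; rewrite !mxE !shuffle_lshift.
have -> : drsubmx N = mxsub (tnth (val s')) (tnth (val t')) M.
  by apply/matrixP=> i j; rewrite !mxE (shuffle_rshift _ ss') (shuffle_rshift _ tt').
rewrite det_shuffle => <-.
set d := \det (mxsub _ _ _).
have -> x y z : x * y * (x * \det M * y * z) = x ^+ 2 * y ^+ 2 * (\det M * z).
  by ring.
by rewrite !shuffle_sign_sqr !mul1r.
Qed.

Lemma card_wedge_index n i : #|wedge_index n i| = 'C(n, i).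
Proof.
by rewrite card_sig -(card_ltn_sorted_tuples i n) cardsE; apply: eq_card.
Qed.

(** [Q] sends an index set to its complement with the shuffle sign. The signs in Jacobi's identity
    split into a row factor and a column factor, so the identity becomes a congruence by one matrix
    independent of [M]. *)
Lemma compound_dual n a b : (a + b)%N = n ->
  exists Q : 'M[F]_(#|wedge_index n a|, #|wedge_index n b|),
    [/\ Q *m Q^T = 1%:M, Q^T *m Q = 1%:M &
    forall M, M \in unitmx ->
      Q *m compound b M *m Q^T = \det M *: (compound a (invmx M))^T].
Proof.
move=> abn; subst n.
have /fin_all_exists [f fE] (s : wedge_index (a + b) a) :
    exists s' : wedge_index (a + b) b, wedge_set s' = ~: wedge_set s.
  apply: wedge_set_surj; have := cardsC (wedge_set s).
  by rewrite card_wedge_set card_ord => /eqP; rewrite eqn_add2l => /eqP.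
have f_inj : injective f.
  move=> s t fst; apply: wedge_set_inj; apply: finset.setC_inj.
  by rewrite -!fE fst.
have [|||Q [Q1 Q2 QE]] := @signed_selection F _ _
    (fun s => enum_rank (f (enum_val s)))
    (fun s : 'I_#|wedge_index (a + b) a| => shuffle_sign F (enum_val s)).
- by rewrite !card_wedge_index -[LHS]bin_sub ?leq_addr // addKn.
- by move=> s t /enum_rank_inj/f_inj/enum_val_inj.
- by move=> s; apply: shuffle_sign_sqr.
exists Q; split=> // M uM; apply/matrixP=> s t; rewrite QE !mxE !enum_rankK.
by rewrite -Jacobi_complementary_minors.
Qed.

Lemma compound_first n : exists Q : 'M[F]_(#|wedge_index n 1|, n),
  [/\ Q *m Q^T = 1%:M, Q^T *m Q = 1%:M &
    forall M, compound 1 M = Q *m M *m Q^T].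
Proof.
have [|||Q [Q1 Q2 QE]] := @signed_selection F #|wedge_index n 1| n
  (fun s => tnth (val (enum_val s)) ord0) (fun=> 1).
- by rewrite card_wedge_index bin1.
- move=> s t st; apply/enum_val_inj/val_inj/eq_from_tnth => i.
  by rewrite !ord1.
- by move=> s; rewrite expr1n.
exists Q; split=> // M; apply/matrixP=> s t; rewrite QE !mul1r.
by rewrite !mxE [LHS]det_mx11 !mxE.
Qed.

(** Selections of [n] among [n.+1] indices are the maps [lift i], and the signs [(-1) ^+ i] turn
    minors into cofactors. Unlike [compound_dual] this covers singular [M], the situation of a
    non-Gorenstein algebra. *)
Lemma compound_last n :
  exists Q : 'M[F]_(n.+1, #|wedge_index n.+1 n|),
  [/\ Q *m Q^T = 1%:M, Q^T *m Q = 1%:M &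
    forall M, Q *m compound n M *m Q^T = (\adj M)^T].
Proof.
have inj_lift (i : 'I_n.+1) : injective (lift i) by apply: lift_inj.
have /fin_all_exists [f fE] (i : 'I_n.+1) :
    exists s : wedge_index n.+1 n, forall j, tnth (val s) j = lift i j.
  have sz : size (map (lift i) (enum 'I_n)) == n.
    by rewrite size_map size_enum_ord.
  have srt : sorted ltn (map val (Tuple sz)).
    rewrite -map_comp sorted_map.
    apply: (@sub_sorted _ (relpre val ltn)); last first.
      by rewrite -sorted_map val_enum_ord iota_ltn_sorted.
    move=> x y /= xy; rewrite /bump; case: (leqP i x) => ix.
      by rewrite (leq_trans ix (ltnW xy)) ltn_add2l.
    exact: leq_trans xy (leq_addl _ _).
  exists (exist _ (Tuple sz) srt) => j.
  by rewrite (tnth_nth (lift i j)) /= (nth_map j) ?size_enum_ord // nth_ord_enum.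
have [|||Q [Q1 Q2 QE]] := @signed_selection F n.+1 #|wedge_index n.+1 n|
    (fun i => enum_rank (f i)) (fun i => (-1) ^+ i).
- by rewrite card_wedge_index binSn.
- move=> i j /enum_rank_inj fij; apply/eqP; apply: contraT => nij.
  rewrite eq_sym in nij; have [k ik _] := unlift_some nij.
  have /tnthP[l] : i \in val (f i) by rewrite fij; apply/tnthP; exists k; rewrite fE.
  by rewrite fE => /eqP; rewrite (negPf (neq_lift _ _)).
- by move=> i; rewrite sqrr_sign.
exists Q; split=> // M; apply/matrixP=> i j; rewrite QE !mxE -exprD.
rewrite !enum_rankK /cofactor; congr (_ * \det _).
by apply/matrixP=> k l; rewrite !mxE !fE.
Qed.

End CompoundCoordinates.

(** * Polynomial functions and multidegrees *)

Section FunctionAlgebras.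
Variable F : fieldType.

(** An abstract class of polynomial functions, so that determinants, adjugates and compounds are
    treated once, both for functions on a line and for functions of the hyperplanes. *)
Definition function_algebra T (P : (T -> F) -> Prop) :=
  [/\ forall c, P (fun=> c),
      forall f g, P f -> P g -> P (fun x => f x + g x)
    & forall f g, P f -> P g -> P (fun x => f x * g x)].

Variables (T : Type) (P : (T -> F) -> Prop).
Hypothesis algP : function_algebra P.

Lemma falg_cst c : P (fun=> c). Proof. by case: algP. Qed.

Lemma falg_add f g : P f -> P g -> P (fun x => f x + g x).
Proof. by case: algP => _ + _; apply. Qed.

Lemma falg_mul f g : P f -> P g -> P (fun x => f x * g x).
Proof. by case: algP => _ _; apply. Qed.

Lemma falg_sum I (r : seq I) (Q : pred I) (f : I -> T -> F) :
  (forall i, P (f i)) -> P (fun x => \sum_(i <- r | Q i) f i x).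
Proof.
move=> Pf; elim: r => [|i r IH].
  by under eq_fun do rewrite big_nil; apply: falg_cst.
under eq_fun do rewrite big_cons.
by case: (Q i) => //; apply: falg_add.
Qed.

Lemma falg_prod I (r : seq I) (Q : pred I) (f : I -> T -> F) :
  (forall i, P (f i)) -> P (fun x => \prod_(i <- r | Q i) f i x).
Proof.
move=> Pf; elim: r => [|i r IH].
  by under eq_fun do rewrite big_nil; apply: falg_cst.
under eq_fun do rewrite big_cons.
by case: (Q i) => //; apply: falg_mul.
Qed.

Lemma falg_exp f k : P f -> P (fun x => f x ^+ k).
Proof.
move=> Pf; elim: k => [|k IH]; first exact: falg_cst.
by under eq_fun do rewrite exprS; apply: falg_mul.
Qed.

Lemma falg_meval k (p : {mpoly F[k]}) (f : T -> 'I_k -> F) :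
  (forall i, P (fun x => f x i)) -> P (fun x => p.@[f x]).
Proof.
move=> Pf; under eq_fun do rewrite mevalE.
apply: falg_sum => m; apply: falg_mul; first exact: falg_cst.
by apply: falg_prod => i; apply: falg_exp.
Qed.

Definition falg_mx m n (A : T -> 'M[F]_(m, n)) :=
  forall i j, P (fun x => A x i j).

Lemma falg_mx_cst m n (A : 'M[F]_(m, n)) : falg_mx (fun=> A).
Proof. by move=> i j; apply: falg_cst. Qed.

Lemma falg_mx_add m n (A B : T -> 'M[F]_(m, n)) :
  falg_mx A -> falg_mx B -> falg_mx (fun x => A x + B x).
Proof.
by move=> PA PB i j; under eq_fun do rewrite mxE; apply: falg_add.
Qed.

Lemma falg_mx_scale m n (c : T -> F) (A : T -> 'M[F]_(m, n)) :
  P c -> falg_mx A -> falg_mx (fun x => c x *: A x).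
Proof.
by move=> Pc PA i j; under eq_fun do rewrite mxE; apply: falg_mul.
Qed.

Lemma falg_mx_sum m n I (r : seq I) (A : I -> T -> 'M[F]_(m, n)) :
  (forall i, falg_mx (A i)) -> falg_mx (fun x => \sum_(i <- r) A i x).
Proof.
by move=> PA i j; under eq_fun do rewrite summxE; apply: falg_sum => k; apply: PA.
Qed.

Lemma falg_mx_mul m n p (A : T -> 'M[F]_(m, n)) (B : T -> 'M[F]_(n, p)) :
  falg_mx A -> falg_mx B -> falg_mx (fun x => A x *m B x).
Proof.
move=> PA PB i j; under eq_fun do rewrite mxE.
by apply: falg_sum => k; apply: falg_mul.
Qed.

Lemma falg_mx_sub m n p q (f : 'I_p -> 'I_m) (g : 'I_q -> 'I_n)
    (A : T -> 'M[F]_(m, n)) :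
  falg_mx A -> falg_mx (fun x => mxsub f g (A x)).
Proof. by move=> PA i j; under eq_fun do rewrite mxE; apply: PA. Qed.

Lemma falg_det n (A : T -> 'M[F]_n) : falg_mx A -> P (fun x => \det (A x)).
Proof.
move=> PA; apply: falg_sum => s; apply: falg_mul; first exact: falg_cst.
by apply: falg_prod => i; apply: PA.
Qed.

Lemma falg_trace n (A : T -> 'M[F]_n) : falg_mx A -> P (fun x => \tr (A x)).
Proof. by move=> PA; apply: falg_sum => i; apply: PA. Qed.

Lemma falg_adj n (A : T -> 'M[F]_n) : falg_mx A -> falg_mx (fun x => \adj (A x)).
Proof.
move=> PA i j; under eq_fun do rewrite mxE.
apply: falg_mul; first exact: falg_cst.
by apply: falg_det => k l; under eq_fun do rewrite !mxE; apply: PA.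
Qed.

Lemma falg_compound n i (A : T -> 'M[F]_n) :
  falg_mx A -> falg_mx (fun x => compound i (A x)).
Proof.
move=> PA s t; under eq_fun do rewrite mxE.
by apply: falg_det; apply: falg_mx_sub.
Qed.

Lemma falg_hyp_poly n k (b : 'I_k -> nat)
    (g : {mpoly F[#|hyp_coord n b|]}) (h : T -> hyperplanes F n b) :
  (forall i j, falg_mx (fun x => h x i j)) -> P (fun x => hyp_poly_at g (h x)).
Proof. by move=> Ph; apply: falg_meval => v; apply: Ph. Qed.

Lemma falg_poly_at n k (p : coord_poly F n k) (y : T -> factor_family F n k) :
  (forall i, falg_mx (fun x => y x i)) -> P (fun x => poly_at p (y x)).
Proof. by move=> Py; apply: falg_meval => v; apply: Py. Qed.

End FunctionAlgebras.

(** * Functions on a line, functions of the hyperplanes, multihomogeneous functions *)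

Section PolynomialFunctions.
Variable F : fieldType.

Definition univariate (f : F -> F) := exists q : {poly F}, forall t, f t = q.[t].

Lemma univariate_algebra : function_algebra univariate.
Proof.
split=> [c|f g [p pE] [q qE]|f g [p pE] [q qE]].
- by exists c%:P => t; rewrite hornerC.
- by exists (p + q) => t; rewrite hornerD pE qE.
- by exists (p * q) => t; rewrite hornerM pE qE.
Qed.

Lemma univariate_id : univariate id.
Proof. by exists 'X => t; rewrite hornerX. Qed.

Definition hyp_function n k (b : 'I_k -> nat) (f : hyperplanes F n b -> F) :=
  exists g, forall h, hyp_poly_at g h = f h.

Lemma hyp_function_algebra n k (b : 'I_k -> nat) :
  function_algebra (@hyp_function n k b).
Proof.
split=> [c|f g [p pE] [q qE]|f g [p pE] [q qE]].
- by exists c%:MP => h; rewrite /hyp_poly_at mevalC.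
- by exists (p + q) => h; rewrite -pE -qE /hyp_poly_at mevalD.
- by exists (p * q) => h; rewrite -pE -qE /hyp_poly_at mevalM.
Qed.

Lemma hyp_function_mx n k (b : 'I_k -> nat) i (j : 'I_(b i)) :
  falg_mx (@hyp_function n k b) (fun h => h i j).
Proof.
move=> s t; pose v : hyp_coord n b := Tagged _ (j, (s, t)).
exists 'X_(enum_rank v) => h.
by rewrite /hyp_poly_at mevalXU enum_rankK.
Qed.

(** The multidegree is a parameter because a sum of multihomogeneous functions is again one only
    when their degrees agree. The zero function has every degree. *)
Definition has_degree n k (e : 'I_k -> nat) (f : factor_family F n k -> F) :=
  exists2 p : coord_poly F n k,
    (forall m, m \in msupp p ->
       forall i, (\sum_(v | tag (enum_val v) == i) m v)%N = e i)
  & forall x, poly_at p x = f x.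

Section Degrees.
Variables n k : nat.
Implicit Types (e : 'I_k -> nat) (f g : factor_family F n k -> F).

Lemma has_degree_cst c : has_degree (fun=> 0%N) (fun _ : factor_family F n k => c).
Proof.
exists c%:MP => [m|x]; last by rewrite /poly_at mevalC.
rewrite msuppC; case: ifP => // _; rewrite inE => /eqP-> i.
by rewrite big1 // => v _; rewrite mnmE.
Qed.

Lemma has_degree0 e : has_degree e (fun _ : factor_family F n k => 0).
Proof.
by exists 0 => [m|x]; rewrite ?msupp0 ?in_nil // /poly_at meval0.
Qed.

Lemma has_degreeD e f g : has_degree e f -> has_degree e g ->
  has_degree e (fun x => f x + g x).
Proof.
move=> [p ep pE] [q eq qE]; exists (p + q) => [m|x].
  by move=> /msuppD_le; rewrite mem_cat => /orP[/ep|/eq].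
by rewrite -pE -qE /poly_at mevalD.
Qed.

Lemma has_degreeM e1 e2 f g : has_degree e1 f -> has_degree e2 g ->
  has_degree (fun i => e1 i + e2 i)%N (fun x => f x * g x).
Proof.
move=> [p ep pE] [q eq qE]; exists (p * q) => [m|x].
  move=> /msuppM_le/allpairsP[[m1 m2] /= [/ep m1p /eq m2q ->]] i.
  by rewrite -m1p -m2q -big_split; apply: eq_bigr => v _; rewrite mnmDE.
by rewrite -pE -qE /poly_at mevalM.
Qed.

Lemma has_degree_eq e1 e2 f g :
  e1 =1 e2 -> f =1 g -> has_degree e1 f -> has_degree e2 g.
Proof. by move=> /funext-> /funext->. Qed.

Lemma has_degreeZ c e f : has_degree e f -> has_degree e (fun x => c * f x).
Proof. by move=> /(has_degreeM (has_degree_cst c)). Qed.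

Lemma has_degreeB e f g : has_degree e f -> has_degree e g ->
  has_degree e (fun x => f x - g x).
Proof.
move=> df /(has_degreeZ (-1)) dg; have := has_degreeD df dg.
by apply: has_degree_eq => // x; rewrite mulN1r.
Qed.

Lemma has_degree_sum I (r : seq I) (Q : pred I) e
    (f : I -> factor_family F n k -> F) :
  (forall i, Q i -> has_degree e (f i)) ->
  has_degree e (fun x => \sum_(i <- r | Q i) f i x).
Proof.
move=> df; elim: r => [|i r IH].
  by under eq_fun do rewrite big_nil; apply: has_degree0.
under eq_fun do rewrite big_cons.
by case Qi: (Q i) => //; apply: has_degreeD => //; apply: df.
Qed.

Lemma has_degree_prod I (r : seq I) (e : I -> 'I_k -> nat)
    (f : I -> factor_family F n k -> F) :
  (forall i, has_degree (e i) (f i)) ->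
  has_degree (fun a => \sum_(i <- r) e i a)%N (fun x => \prod_(i <- r) f i x).
Proof.
move=> df; elim: r => [|i r IH].
  by apply: has_degree_eq (has_degree_cst 1) => x; rewrite big_nil.
by apply: has_degree_eq (has_degreeM (df i) IH) => x; rewrite big_cons.
Qed.

Lemma has_degree_exp e f q : has_degree e f ->
  has_degree (fun i => q * e i)%N (fun x => f x ^+ q).
Proof.
move=> df; elim: q => [|q IH]; first exact: has_degree_cst.
by apply: has_degree_eq (has_degreeM df IH) => x; rewrite ?exprS ?mulSn.
Qed.

Lemma has_degree_coord (i : 'I_k) s t :
  has_degree (fun j => (i == j) : nat) (fun x : factor_family F n k => x i s t).
Proof.
pose v : Defs.coord n k := Tagged _ (s, t).
exists 'X_(enum_rank v) => [m|x]; last by rewrite /poly_at mevalXU enum_rankK.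
rewrite msuppX inE => /eqP-> j.
rewrite (bigID (pred1 (enum_rank v))) /= [X in (_ + X)%N]big1 ?addn0; last first.
  by move=> w /andP[_ nw]; rewrite mnm1E eq_sym (negPf nw).
have [<-|nij] := eqVneq i j.
  rewrite (big_pred1 (enum_rank v)) ?mnm1E ?eqxx // => w.
  rewrite /=; have [->|_] := eqVneq w (enum_rank v); last by rewrite andbF.
  by rewrite enum_rankK eqxx.
rewrite big1 // => w /andP[+ /eqP wv]; rewrite wv enum_rankK /=.
by rewrite (negPf nij).
Qed.

Lemma has_degree_det q e (A : factor_family F n k -> 'M[F]_q) :
  (forall i j, has_degree e (fun x => A x i j)) ->
  has_degree (fun i => q * e i)%N (fun x => \det (A x)).
Proof.
move=> dA; apply: has_degree_sum => s _; apply: has_degreeZ.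
have := has_degree_prod (index_enum 'I_q) (fun i => dA i (s i)).
by apply: has_degree_eq => // i; rewrite sum_nat_const card_ord.
Qed.

(** All equations satisfied by points of a closure are obtained from here: it remains to find a
    degree and to check the equation on the image. *)
Lemma zariski_closure_vanish S x e f : zariski_closure S x -> has_degree e f ->
  (forall y, S y -> f y = 0) -> f x = 0.
Proof.
move=> [_ Sx] [p ep pE] f0; rewrite -pE; apply: Sx => [|y Sy].
  by exists e.
by rewrite pE f0.
Qed.

Lemma poly_at_scale p (c : 'I_k -> F) (x : factor_family F n k) e :
  (forall m, m \in msupp p ->
       forall i, (\sum_(v | tag (enum_val v) == i) m v)%N = e i) ->
  poly_at p (fun i => c i *: x i) = \prod_i c i ^+ e i * poly_at p x.
Proof.
move=> ep; rewrite /poly_at !mevalE mulr_sumr big_seq [RHS]big_seq.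
apply: eq_bigr => m /ep me; rewrite mulrCA; congr (_ * _).
under eq_bigr do rewrite mxE exprMn.
rewrite big_split /=; congr (_ * _).
rewrite (partition_big (fun v => tag (enum_val v)) xpredT) //=.
apply: eq_bigr => i _; rewrite -me.
rewrite (eq_bigr (fun v => c i ^+ m v)) => [|v /eqP-> //].
by rewrite prodrXr.
Qed.

(** Factor [i] of [y x] is linear in factor [e' i] of [x], so the degree in factor [j] collects the
    [e i] with [e' i = j]. *)
Lemma has_degree_subst p e (e' : 'I_k -> 'I_k)
    (y : factor_family F n k -> factor_family F n k) :
  (forall m, m \in msupp p ->
       forall i, (\sum_(v | tag (enum_val v) == i) m v)%N = e i) ->
  (forall i s t, has_degree (fun j => (e' i == j) : nat) (fun x => y x i s t)) ->
  has_degree (fun j => \sum_(i | e' i == j) e i)%N (fun x => poly_at p (y x)).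
Proof.
move=> ep dy; have -> : (fun x => poly_at p (y x)) = fun x =>
    \sum_(m <- msupp p | m \in msupp p) p@_m * \prod_v
      (y x (tag (enum_val v)) (tagged (enum_val v)).1 (tagged (enum_val v)).2) ^+ m v.
  by apply/funext=> x; rewrite /poly_at mevalE big_seq.
apply: has_degree_sum => m /ep me; apply: has_degreeZ.
have := has_degree_prod (index_enum 'I_#|Defs.coord n k|)
  (fun v => has_degree_exp (m v) (dy (tag (enum_val v)) (tagged (enum_val v)).1
    (tagged (enum_val v)).2)).
apply: has_degree_eq => // j.
under [RHS]eq_bigr do rewrite -me.
rewrite (exchange_big_dep xpredT) //= ; apply: eq_bigr => v _.
rewrite (eq_bigl (fun i => (i == tag (enum_val v)) && (e' i == j))); last first.
  by move=> i; rewrite andbC eq_sym.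
rewrite big_mkcondr big_pred1_eq.
by case: eqP; rewrite ?muln1 ?muln0.
Qed.

End Degrees.
End PolynomialFunctions.

(** * General hyperplane sections *)

Section Counting.
Variable F : numFieldType.

Lemma exists_nonroot (q : {poly F}) : q != 0 -> exists t, q.[t] != 0.
Proof.
move=> q0; pose r := [seq i%:R : F | i <- iota 0 (size q)].
have ur : uniq r.
  by rewrite map_inj_uniq ?iota_uniq // => i j /eqP; rewrite eqr_nat => /eqP.
have /allPn[t _ nt] : ~~ all (root q) r.
  apply/negP=> rr; have := max_poly_roots q0 rr ur.
  by rewrite size_map size_iota ltnn.
by exists t.
Qed.

Lemma univariate_meet (f g : F -> F) : univariate f -> univariate g ->
  (exists t, f t != 0) -> (exists t, g t != 0) ->
  exists t, f t != 0 /\ g t != 0.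
Proof.
move=> [p pE] [q qE] [t ft] [u gu].
have [v] : exists v, (p * q).[v] != 0.
  apply: exists_nonroot; rewrite mulf_neq0 //.
    by apply: contraNneq ft => p0; rewrite pE p0 horner0.
  by apply: contraNneq gu => q0; rewrite qE q0 horner0.
by rewrite hornerM mulf_eq0 negb_or -pE -qE => /andP[fv gv]; exists v.
Qed.

Lemma univariate_eq0 (f : F -> F) (g : F -> F) : univariate f -> univariate g ->
  (exists t, g t != 0) -> (forall t, g t != 0 -> f t = 0) -> forall t, f t = 0.
Proof.
move=> uf ug g0 fg t; apply/eqP; apply: contraT => ft.
have [|v [+ gv]] := univariate_meet uf ug _ g0; first by exists t.
by rewrite fg ?eqxx.
Qed.

Section Ambient.
Variables n k : nat.

Lemma same_point_sym (x y : factor_family F n k) : same_point x y -> same_point y x.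
Proof.
move=> xy i; have [c c0 ->] := xy i; exists c^-1; first by rewrite invr_eq0.
by rewrite scalerA mulVf // scale1r.
Qed.

Lemma same_point_trans (y x z : factor_family F n k) :
  same_point x y -> same_point y z -> same_point x z.
Proof.
move=> xy yz i; have [c c0 ->] := xy i; have [d d0 ->] := yz i.
by exists (c * d); rewrite ?mulf_neq0 // scalerA.
Qed.

Lemma has_card_points_leq (S : factor_family F n k -> Prop) N M :
  has_card_points S N -> has_card_points S M -> (N <= M)%N.
Proof.
move=> [s [sS s_inj _]] [t [_ _ t_surj]].
have /fin_all_exists [f fE] a := t_surj _ (sS a).
have f_inj : injective f.
  move=> a b fab; apply/s_inj/(same_point_trans (fE a)).
  by rewrite fab; apply/same_point_sym/fE.
by have := leq_card f f_inj; rewrite !card_ord.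
Qed.

Lemma has_card_points_uniq (S : factor_family F n k -> Prop) N M :
  has_card_points S N -> has_card_points S M -> N = M.
Proof.
by move=> SN SM; apply/eqP; rewrite eqn_leq !(has_card_points_leq SN, has_card_points_leq SM).
Qed.

(** On the line joining a witness of each open set, both polynomials restrict to nonzero univariate
    ones, which have a common non-root. This is what makes the general count unique. *)
Lemma for_general_meet (b : 'I_k -> nat) (P Q : hyperplanes F n b -> Prop) :
  for_general_hyperplanes P -> for_general_hyperplanes Q -> exists h, P h /\ Q h.
Proof.
move=> [p [[h hs ph] pP]] [q [[h' h's qh'] qQ]].
pose l t : hyperplanes F n b := fun i j => (1 - t) *: h i j + t *: h' i j.
have ls t : sym_hyperplanes (l t).
  by move=> i j; rewrite linearD !linearZ /= hs h's.
have ul i j : falg_mx (@univariate F) (fun t => l t i j).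
  have U := univariate_algebra F.
  apply: (falg_mx_add U); apply: (falg_mx_scale U); try exact: falg_mx_cst.
    under eq_fun do rewrite -mulN1r.
    apply: (falg_add U); first exact: (falg_cst U).
    by apply: (falg_mul U); [exact: (falg_cst U)|exact: univariate_id].
  exact: univariate_id.
have l0 : l 0 = h.
  do 2!apply: functional_extensionality_dep => ?.
  by rewrite /l subr0 scale1r scale0r addr0.
have l1 : l 1 = h'.
  do 2!apply: functional_extensionality_dep => ?.
  by rewrite /l subrr scale1r scale0r add0r.
have uf := @falg_hyp_poly F F _ (univariate_algebra F).
have [||t [pt qt]] := univariate_meet (uf _ _ _ p _ ul) (uf _ _ _ q _ ul).
- by exists 0; rewrite l0.
- by exists 1; rewrite l1.
- by exists (l t); split; [apply: pP|apply: qQ].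
Qed.

Lemma general_countE (b : 'I_k -> nat) (X : factor_family F n k -> Prop) N :
  is_general_count b X N -> general_count b X = N.
Proof.
move=> XN; have XM : is_general_count b X (general_count b X).
  exact: (@classical_sets.xgetPex _ 0%N (is_general_count b X) (ex_intro _ N XN)).
have [h [hM hN]] := for_general_meet XM XN.
exact: has_card_points_uniq hM hN.
Qed.

End Ambient.

(** Frees the dependent types of [nb_factors L] by substituting a chosen [k] for it. *)
Lemma char_numberE n (L : {vspace 'M[F]_n}) (b : 'I_n.-1 -> nat) k
    (kn : (k <= n.-1)%N) : nb_factors L = k ->
  (forall j : 'I_n.-1, (k <= j)%N -> b j = 0%N) ->
  char_number L b = general_count (fun i : 'I_k => b (widen_ord kn i)) (X_ (k:=k) L).
Proof.
move=> Lk; case: k / Lk kn => kn b0; rewrite /char_number ifT.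
  congr general_count; apply/funext=> i; congr b; exact: val_inj.
by apply/forallP=> j; apply/implyP=> /b0->.
Qed.

End Counting.

(** The coordinates of [v - projv L v] are functionals vanishing on [L]. This turns linear equations
    on a closure into membership in [L]; for [L = 0] it says that functionals separate points. *)
Lemma memv_annihilated (F : fieldType) (V : vectType F) (L : {vspace V}) v :
  (forall f : 'Hom(V, F^o), (forall u, u \in L -> f u = 0) -> f v = 0) -> v \in L.
Proof.
move=> fv; suff /eqP : v - projv L v = 0.
  by rewrite subr_eq0 => /eqP->; apply: memv_proj.
rewrite (coord_vbasis (memvf (v - projv L v))) big1 // => i _.
pose f : 'Hom(V, F^o) := (linfun (coord (vbasis {:V}) i : V -> F^o) \o (\1 - projv L))%VF.
have fE u : f u = coord (vbasis {:V}) i (u - projv L u).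
  by rewrite !lfun_simp.
rewrite -fE fv ?scale0r // => u uL.
by rewrite fE projv_id // subrr linear0.
Qed.

(** * The top power of the first class *)

Section FirstFactor.
Variable F : numFieldType.

Lemma Phi_in_X n k (L : {vspace 'M[F]_n}) M :
  M \in L -> M^T = M -> M != 0 -> (k <= \rank M)%N ->
  X_ L (fun i : 'I_k => compound i.+1 M).
Proof.
move=> ML Ms M0 rM; split=> [i|p _]; last by apply; exists M.
split; first by rewrite trmx_compound Ms.
by apply: compound_neq0; apply: leq_trans rM.
Qed.

Lemma has_degree_linear n k (i : 'I_k) (f : 'Hom('M[F]_#|wedge_index n i.+1|, F^o)) :
  has_degree (fun j => (i == j) : nat) (fun x : factor_family F n k => f (x i)).
Proof.
apply: has_degree_eq (_ : has_degree _ (fun x : factor_family F n k =>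
   \sum_s \sum_t f (delta_mx s t) * x i s t)) => // [x|].
  rewrite [in RHS](matrix_sum_delta (x i)) linear_sum; apply: eq_bigr => s _.
  rewrite linear_sum; apply: eq_bigr => t _; rewrite linearZ /=.
  by rewrite mulrC.
do 2!apply: has_degree_sum => ? _.
by apply: has_degreeZ; apply: has_degree_coord.
Qed.

(** Both conditions are closed: the linear equations of [L] on the first factor, and the equations
    making [x i] proportional to the compound. They are cross-multiplied, hence empty where the
    compound vanishes; a use of them needs a matrix of large rank. *)
Lemma X_first n k (L : {vspace 'M[F]_n}) (x : factor_family F n k.+1) :
  X_ L x -> exists M, [/\ M \in L, x ord0 = compound 1 M &
    forall i s t s' t', x i s t * compound i.+1 M s' t' =
                        x i s' t' * compound i.+1 M s t].
Proof.
move=> Xx; have [Q [Q1 Q2 QE]] := compound_first F n.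
have QK (M : 'M_n) : Q^T *m compound 1 M *m Q = M.
  by rewrite QE !mulmxA Q2 mul1mx -mulmxA Q2 mulmx1.
exists (Q^T *m x ord0 *m Q); split.
- apply: memv_annihilated => f f0.
  pose g : 'Hom('M[F]_#|wedge_index n 1|, F^o) :=
    (f \o (linfun (mulmxr Q) \o linfun (mulmx Q^T)))%VF.
  have gE N : g N = f (Q^T *m N *m Q) by rewrite !comp_lfunE !lfunE.
  have := zariski_closure_vanish Xx (has_degree_linear (i := ord0) g).
  rewrite -gE; apply=> _ [M [ML _ _ ->]]; rewrite gE QK; exact: f0.
- by rewrite QE !mulmxA Q1 mul1mx -mulmxA Q1 mulmx1.
move=> i s t s' t'; apply/eqP; rewrite -subr_eq0; apply/eqP.
have dM a c : has_degree (fun j => (ord0 == j) : nat)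
    (fun x : factor_family F n k.+1 => (Q^T *m x ord0 *m Q) a c).
  apply: has_degree_eq (_ : has_degree _ (fun x : factor_family F n k.+1 =>
     \sum_u \sum_v (Q^T a v * Q u c) * x ord0 v u)) => // [y|].
    rewrite !mxE; apply: eq_bigr => u _; rewrite !mxE big_distrl /=.
    by apply: eq_bigr => v _; rewrite mulrAC.
  do 2!apply: has_degree_sum => ? _.
  by apply: has_degreeZ; apply: has_degree_coord.
have dC a c : has_degree (fun j => i.+1 * (ord0 == j))%N
    (fun x : factor_family F n k.+1 => compound i.+1 (Q^T *m x ord0 *m Q) a c).
  apply: has_degree_eq (has_degree_det (A := fun x : factor_family F n k.+1 =>
    mxsub (tnth (val (enum_val a))) (tnth (val (enum_val c)))
          (Q^T *m x ord0 *m Q)) _) => // [y|u v]; first by rewrite mxE.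
  by apply: has_degree_eq (dM _ _) => // y; rewrite [RHS]mxE.
have df := has_degreeB (has_degreeM (has_degree_coord F s t) (dC s' t'))
  (has_degreeM (has_degree_coord F s' t') (dC s t)).
apply: (zariski_closure_vanish Xx df) => y [M [_ _ _ yE]].
by rewrite !yE QK mulrC subrr.
Qed.

Lemma basis_with_head (V : vectType F) d (L : {vspace V}) v :
  v \in L -> v != 0 -> \dim L = d.+1 ->
  exists X : d.+1.-tuple V, basis_of L X /\ X`_0 = v.
Proof.
move=> vL v0 dL.
have LE : (<[v]> + (L :\: <[v]>))%VS = L.
  rewrite addvC -[RHS](addv_diff_cap L <[v]>); congr (_ + _)%VS.
  by apply/esym/capv_idPr; rewrite -memvE.
have bX : basis_of L (v :: vbasis (L :\: <[v]>)).
  rewrite -[L in basis_of L _]LE -cat1s.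
  apply: cat_basis; rewrite ?seq1_basis ?vbasisP //.
  by apply/directv_addP; rewrite capvC capv_diff.
have sz : size (v :: vbasis (L :\: <[v]>)) == d.+1.
  by have := basis_free bX; rewrite /free (span_basis bX) dL eq_sym.
by exists (Tuple sz).
Qed.

Lemma symmetric_trace_form n (f : 'Hom('M[F]_n, F^o)) :
  exists H : 'M[F]_n, H^T = H /\ forall M, M^T = M -> \tr (H *m M) = f M.
Proof.
pose H0 : 'M[F]_n := \matrix_(a, b) f (delta_mx b a).
have H0E M : \tr (H0 *m M) = f M.
  rewrite [in RHS](matrix_sum_delta M) exchange_big linear_sum.
  apply: eq_bigr => a _; rewrite mxE linear_sum; apply: eq_bigr => b _.
  by rewrite mxE linearZ /= mulrC.
exists (2^-1 *: (H0 + H0^T)); split=> [|M Ms].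
  by rewrite linearZ linearD /= trmxK addrC.
rewrite -scalemxAl mxtraceZ mulmxDl mxtraceD H0E.
rewrite -[X in _ + X]mxtrace_tr trmx_mul trmxK Ms mxtrace_mulC H0E.
suff half (y : F) : 2^-1 * (y + y) = y by apply: half.
by rewrite -mulr2n -(mulr_natl y) mulrA mulVf ?pnatr_eq0 // mul1r.
Qed.

Lemma general_count_first n k (L : {vspace 'M[F]_n}) (b : 'I_k.+1 -> nat) :
  (forall M, M \in L -> M^T = M) -> \dim L = (b ord0).+1 ->
  (forall i, i != ord0 -> b i = 0%N) ->
  (exists2 M, M \in L & (k < \rank M)%N) ->
  is_general_count b (X_ (k := k.+1) L) 1.
Proof.
move=> Lsym dimL b0 [Ms MsL rMs].
have [Q [Q1 Q2 QE]] := compound_first F n.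
have Ms0 : Ms != 0 by apply: contraTneq rMs => ->; rewrite mxrank0.
set d := b ord0 in dimL; have [X [bX X0]] := basis_with_head MsL Ms0 dimL.
pose Mw (w : 'rV[F]_d.+1) := \sum_j w 0 j *: X`_j.
have MwL w : Mw w \in L.
  by apply: memv_suml => j _; apply/memvZ/(basis_mem bX)/mem_nth; rewrite size_tuple.
have MwZ c w : Mw (c *: w) = c *: Mw w.
  by rewrite /Mw scaler_sumr; apply: eq_bigr => j _; rewrite mxE scalerA.
(* In the basis [X], the hyperplane equations fill all columns but the first, which is the
   functional [w 0 ord0] and makes the matrix square. The row [w0] of the adjugate is then Cramer's
   solution of the equations, polynomial in [h]. *)
pose At (h : hyperplanes F n b) : 'M[F]_d.+1 := \matrix_(j, i)
  if unlift ord0 i is Some i' then \tr (h ord0 i' *m compound 1 X`_j)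
  else (j == ord0)%:R.
have AtE h w i : (w *m At h) 0 (lift ord0 i) = \tr (h ord0 i *m compound 1 (Mw w)).
  rewrite mxE QE /Mw mulmx_sumr mulmx_suml mulmx_sumr linear_sum.
  apply: eq_bigr => j _; rewrite mxE liftK QE.
  by rewrite -scalemxAr -scalemxAl -scalemxAr linearZ.
have At0 h w : (w *m At h) 0 ord0 = w 0 ord0.
  rewrite mxE (bigD1 ord0) //= big1 ?addr0 => [|j j0].
    by rewrite mxE unlift_none eqxx mulr1.
  by rewrite mxE unlift_none (negPf j0) mulr0.
pose w0 h := row ord0 (\adj (At h)).
have w0A h : w0 h *m At h = \det (At h) *: delta_mx 0 ord0.
  by rewrite -row_mul mul_adj_mx -scalemx1 linearZ /= row1.
(* The open condition: the linear system has a unique solution up to scalars, and a fixed minor of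
   size [k.+1] is nonzero at that solution. *)
have /matrix0Pn [s [t Mst]] := compound_neq0 rMs.
have [g gE] : hyp_function
    (fun h => \det (At h) * compound k.+1 (Mw (w0 h)) s t).
  have H := @hyp_function_algebra F n _ b.
  have HA : falg_mx (@hyp_function F n _ b) At.
    move=> j i; under eq_fun do rewrite mxE.
    case: (unlift ord0 i) => [i'|]; last exact: (falg_cst H).
    apply: (falg_trace H); apply: (falg_mx_mul H); last exact: (falg_mx_cst H).
    exact: hyp_function_mx.
  apply: (falg_mul H); first exact: (falg_det H).
  apply: (falg_compound H); apply: (falg_mx_sum H) => j.
  apply: (falg_mx_scale H); last exact: (falg_mx_cst H).
  by under eq_fun do rewrite mxE; apply: (falg_adj H).
exists g; split.
  have /fin_all_exists [H HE] (i : 'I_d) : exists H : 'M[F]_n, H^T = H /\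
      forall M, M^T = M -> \tr (H *m M) = coord X (lift ord0 i) M.
    have [H [Hs HE]] := symmetric_trace_form
      (linfun (coord X (lift ord0 i) : 'M[F]_n -> F^o)).
    by exists H; split=> // M /HE ->; rewrite lfunE.
  pose v (i : 'I_d) := Q *m H i *m Q^T.
  pose h : hyperplanes F n b := @dfwith _ (fun i => 'I_(b i) -> 'M[F]_#|wedge_index n i.+1|)
    (fun i _ => 0) ord0 v.
  have hE : h ord0 = v by rewrite /h dfwith_in.
  exists h.
    move=> i; have [->|i0] := eqVneq i ord0 => j.
      by rewrite hE /v !trmx_mul trmxK (HE j).1 mulmxA.
    by exfalso; have := leq_ltn_trans (leq0n j) (ltn_ord j); rewrite b0.
  have AtI : At h = 1%:M.
    apply/matrixP=> j i; rewrite !mxE; case: unliftP => [i' ->|-> //].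
    rewrite hE /v QE.
    have -> : Q *m H i' *m Q^T *m (Q *m X`_j *m Q^T) = Q *m (H i' *m X`_j *m Q^T).
      by rewrite !mulmxA -(mulmxA _ Q^T Q) Q2 mulmx1.
    rewrite mxtrace_mulC -(mulmxA _ Q^T Q) Q2 mulmx1 (HE i').2; last first.
      by apply/Lsym/(basis_mem bX)/mem_nth; rewrite size_tuple.
    by rewrite coord_free ?(basis_free bX) // eq_sym.
  rewrite gE /w0 AtI det1 mul1r; suff -> : Mw (row ord0 (\adj 1%:M)) = Ms by [].
  rewrite adj1 /Mw (bigD1 ord0) //= big1 ?addr0 => [|j j0].
    by rewrite !mxE eqxx scale1r X0.
  by rewrite !mxE eq_sym (negPf j0) scale0r.
move=> h hs; rewrite gE mulf_eq0 negb_or => /andP[detA minA].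
pose M0 := Mw (w0 h).
have M0r : (k < \rank M0)%N.
  move: minA; rewrite mxE; exact: leq_rank_minor.
have M00 : M0 != 0 by apply: contraTneq M0r => ->; rewrite mxrank0.
exists (fun _ i => compound i.+1 M0); split=> [_|a c _|x [Xx xh]].
- split; first by apply: Phi_in_X => //; [exact: MwL|exact/Lsym/MwL].
  move=> i; have [-> j|i0 j] := eqVneq i ord0.
    by rewrite -AtE w0A !mxE (eq_sym (lift _ _)) (negPf (neq_lift _ _)) andbF mulr0.
  by exfalso; have := leq_ltn_trans (leq0n j) (ltn_ord j); rewrite b0.
- by rewrite !ord1.
have [M [ML x0E xE]] := X_first Xx.
have [w MwE] : exists w, M = Mw w.
  exists (\row_j coord X j M); rewrite [LHS](coord_basis bX ML).
  by apply: eq_bigr => j _; rewrite mxE.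
have wA : w *m At h = w 0 ord0 *: delta_mx 0 ord0.
  apply/rowP=> i; case: (unliftP ord0 i) => [i' ->|->].
    rewrite AtE -MwE -x0E xh !mxE.
    by rewrite (eq_sym (lift _ _)) (negPf (neq_lift _ _)) andbF mulr0.
  by rewrite At0 !mxE eqxx mulr1.
have {}MwE : M = (w 0 ord0 / \det (At h)) *: M0.
  rewrite MwE -MwZ; congr Mw.
  have /(congr1 (mulmxr (\adj (At h)))) := wA.
  rewrite /= -mulmxA mul_mx_adj mul_mx_scalar -scalemxAl -rowE -/(w0 h).
  move=> /(congr1 (GRing.scale (\det (At h))^-1)).
  by rewrite !scalerA mulVf // scale1r mulrC.
have cN : w 0 ord0 / \det (At h) != 0.
  have := (Xx.1 ord0).2; rewrite x0E MwE QE; apply: contraNneq => ->.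
  by rewrite scale0r mulmx0 mul0mx.
exists 0 => i.
(* The large rank makes every compound nonzero, so proportionality determines [x i] up to a
   scalar. *)
have : compound i.+1 M != 0.
  rewrite MwE compoundZ scaler_eq0 expf_eq0 (negPf cN) andbF /=.
  by apply: compound_neq0; apply: leq_trans M0r.
move=> /matrix0Pn [s' [t' st']].
have xM : x i = (x i s' t' / compound i.+1 M s' t') *: compound i.+1 M.
  by apply/matrixP=> a c; rewrite mxE mulrAC -xE mulfK.
have := (Xx.1 i).2; rewrite xM MwE compoundZ scalerA.
set e := _ * _ => nz; exists e => //.
by apply: contraNneq nz => ->; rewrite scale0r.
Qed.

End FirstFactor.

(** * Duality *)

Section Duality.
Variable F : numFieldType.

(** [M + t *: G] is invertible as soon as [t] is not an eigenvalue of [- (M *m invmx G)]. *)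
Lemma exists_unit_shift n (M G : 'M[F]_n) :
  G \in unitmx -> exists t, M + t *: G \in unitmx.
Proof.
move=> uG; pose A := - (M *m invmx G).
have [t] : exists t, (char_poly A).[t] != 0.
  exact/exists_nonroot/monic_neq0/char_poly_monic.
rewrite -/(root _ _) -eigenvalue_root_char /eigenvalue negbK kermx_eq0.
rewrite row_free_unit => uAt; exists t.
have -> : M + t *: G = - (A - t%:M) *m G.
  by rewrite opprB opprK mulmxDl mulmxKV // mul_scalar_mx addrC.
by rewrite unitmx_mul uG andbT -scaleN1r unitmxZ // unitrN1.
Qed.

(** Invertible matrices are dense in [L]: along the line [M + t *: G] the function vanishes wherever
    the determinant does not, hence also at [t = 0]. Equations may therefore be checked where
    inversion is defined. *)
Lemma zariski_closure_unit n k (L : {vspace 'M[F]_n}) G e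
    (f : factor_family F n k -> F) x :
  G \in L -> G \in unitmx -> has_degree e f ->
  (forall M, M \in L -> M \in unitmx -> f (fun i => compound i.+1 M) = 0) ->
  X_ L x -> f x = 0.
Proof.
move=> GL uG df fM Xx; apply: (zariski_closure_vanish Xx df) => y [M [ML _ _ yE]].
have -> : y = (fun i => compound i.+1 M) by apply: functional_extensionality_dep.
case: (df) => p _ pE.
have U := univariate_algebra F.
have UM : falg_mx (@univariate F) (fun t => M + t *: G).
  apply: (falg_mx_add U); first exact: (falg_mx_cst U).
  by apply: (falg_mx_scale U); [exact: univariate_id|exact: (falg_mx_cst U)].
suff /(_ 0) : forall t, poly_at p (fun i : 'I_k => compound i.+1 (M + t *: G)) = 0.
  by rewrite scale0r addr0 pE.
apply: (univariate_eq0 (g := fun t => \det (M + t *: G))).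
- by apply: (falg_poly_at U) => i; apply: (falg_compound U).
- exact: (falg_det U).
- have [t] := exists_unit_shift M uG; rewrite unitmxE unitfE.
  by exists t.
move=> t; rewrite -unitfE -[_ \is a _]unitmxE pE; apply: fM.
by rewrite memvD ?memvZ.
Qed.

Section Congruence.
Variables n k : nat.

(* Reversing the order of the factors matches [/\^i V] with [/\^(n-i) V]. *)
Definition dual_family
    (A : forall i : 'I_k, 'M[F]_(#|wedge_index n i.+1|, #|wedge_index n (rev_ord i).+1|))
    (x : factor_family F n k) : factor_family F n k :=
  fun i => A i *m x (rev_ord i) *m (A i)^T.

(** A multihomogeneous equation of [X_ L] pulls back along [dual_family A] to a multihomogeneous
    function. It vanishes at invertible matrices, because the scalars [c i] only rescale
    representatives. The left inverses [B] keep coordinates nonzero. *)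
Lemma dual_family_X A B (L : {vspace 'M[F]_n}) G :
  G \in L -> G \in unitmx -> (0 < n)%N -> (k <= n)%N ->
  (forall i, B i *m A i = 1%:M) ->
  (forall M, M \in L -> M \in unitmx -> exists N (c : 'I_k -> F),
     [/\ N \in L, N \in unitmx &
      forall i, dual_family A (fun i => compound i.+1 M) i = c i *: compound i.+1 N]) ->
  forall x, X_ L x -> X_ L (dual_family A x).
Proof.
move=> GL uG n0 kn BA AL x Xx; split=> [i|p [e ep] p0].
  have [xs x0] := Xx.1 (rev_ord i); split.
    by rewrite /dual_family !trmx_mul trmxK xs mulmxA.
  apply: contraNneq x0 => Ax0.
  have := congr1 (fun z => B i *m z *m (B i)^T) Ax0.
  rewrite mulmx0 mul0mx /dual_family !mulmxA BA mul1mx -mulmxA -trmx_mul BA.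
  by rewrite trmx1 mulmx1 => ->.
have df : has_degree (fun j => \sum_(i | rev_ord i == j) e i)%N
    (fun x => poly_at p (dual_family A x)).
  apply: (has_degree_subst (e' := @rev_ord k)) => // i s t.
  apply: has_degree_eq (_ : has_degree _ (fun x : factor_family F n k =>
     \sum_u \sum_v (A i s v * (A i)^T u t) * x (rev_ord i) v u)) => // [y|].
    rewrite /dual_family !mxE; apply: eq_bigr => u _; rewrite !mxE big_distrl /=.
    by apply: eq_bigr => v _; rewrite mulrAC.
  do 2!apply: has_degree_sum => ? _.
  by apply: has_degreeZ; apply: has_degree_coord.
apply: (zariski_closure_unit GL uG df _ Xx) => M ML uM.
have [N [c [NL uN NE]]] := AL M ML uM.
rewrite (functional_extensionality_dep NE) (poly_at_scale _ _ ep).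
rewrite p0 ?mulr0 //; exists N; split=> //; last by rewrite mxrank_unit.
by apply: contraTneq n0 => N0; rewrite -(mxrank_unit uN) N0 mxrank0.
Qed.

(** The two indices are independent and specialized to [j = rev_ord i]: since [rev_ord (rev_ord i)]
    equals [i] only propositionally, an index that can be generalized is needed to rewrite in the
    types. *)
Variables (Z : forall i j : 'I_k, 'M[F]_(#|wedge_index n i.+1|, #|wedge_index n j.+1|))
  (Y : forall i j : 'I_k, 'M[F]_(#|wedge_index n j.+1|, #|wedge_index n i.+1|)).
Hypotheses (ZY : forall i, Z i (rev_ord i) *m Y i (rev_ord i) = 1%:M)
  (YZ : forall i, Y i (rev_ord i) *m Z i (rev_ord i) = 1%:M).

Let sigma := dual_family (fun i => Z i (rev_ord i)).
Let tau := dual_family (fun i => Y (rev_ord i) i).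

Lemma YZ_rev i : Y (rev_ord i) i *m Z (rev_ord i) i = 1%:M.
Proof. by have := YZ (rev_ord i); rewrite rev_ordK. Qed.

Lemma ZY_rev i : Z (rev_ord i) i *m Y (rev_ord i) i = 1%:M.
Proof. by have := ZY (rev_ord i); rewrite rev_ordK. Qed.

Lemma dual_familyK x : tau (sigma x) = x.
Proof.
apply: functional_extensionality_dep => i; rewrite /tau /sigma /dual_family.
move: (rev_ordK i); move: (rev_ord (rev_ord i)) => j ->.
by rewrite !mulmxA YZ_rev mul1mx -mulmxA -trmx_mul YZ_rev trmx1 mulmx1.
Qed.

Lemma dual_familyVK y : sigma (tau y) = y.
Proof.
apply: functional_extensionality_dep => i; rewrite /tau /sigma /dual_family.
move: (rev_ordK i); move: (rev_ord (rev_ord i)) => j ->.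
by rewrite !mulmxA ZY mul1mx -mulmxA -trmx_mul ZY trmx1 mulmx1.
Qed.

Lemma same_point_dual A x y : same_point x y ->
  same_point (dual_family A x) (dual_family A y).
Proof.
move=> xy i; have [c c0 xE] := xy (rev_ord i); exists c => //.
by rewrite /dual_family xE -scalemxAr -scalemxAl.
Qed.

(** Hyperplanes pull back by the adjoint congruence for the trace pairing, so [sigma] carries the
    section of [X] by [pull h'] bijectively onto its section by [h']. Genericity transfers because
    [pull] is polynomial and reaches [h0]. *)
Lemma is_general_count_dual (X : factor_family F n k -> Prop) (b b' : 'I_k -> nat) N :
  (forall x, X x -> X (sigma x)) -> (forall x, X x -> X (tau x)) ->
  (forall i, b' i = b (rev_ord i)) ->
  is_general_count b X N -> is_general_count b' X N.
Proof.
move=> Xs Xt bE [g [[h0 h0s gh0] gX]].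
have bE' i : b i = b' (rev_ord i) by rewrite bE rev_ordK.
pose pull (h' : hyperplanes F n b') : hyperplanes F n b := fun i j =>
  (Z (rev_ord i) i)^T *m h' (rev_ord i) (cast_ord (bE' i) j) *m Z (rev_ord i) i.
have pull_sym h' : sym_hyperplanes h' -> sym_hyperplanes (pull h').
  by move=> h's i j; rewrite /pull !trmx_mul trmxK h's mulmxA.
have trE (i j : 'I_k) (h : 'M[F]_#|wedge_index n i.+1|) (x : 'M[F]_#|wedge_index n j.+1|) :
    \tr (h *m (Z i j *m x *m (Z i j)^T)) = \tr ((Z i j)^T *m h *m Z i j *m x).
  by rewrite !mulmxA mxtrace_mulC !mulmxA.
have on_pull h' x : on_hyperplanes (pull h') x <-> on_hyperplanes h' (sigma x).
  split=> hx i j; rewrite /pull /sigma /dual_family.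
    rewrite trE; have := hx (rev_ord i) (cast_ord (bE i) j); rewrite /pull.
    have : val (cast_ord (bE' _) (cast_ord (bE i) j)) = val j by [].
    move: (rev_ordK i) (cast_ord (bE' _) (cast_ord (bE i) j)).
    by move: (rev_ord (rev_ord i)) => _ -> j' /val_inj ->.
  have := hx (rev_ord i) (cast_ord (bE' i) j); rewrite /sigma /dual_family trE.
  by move: (rev_ordK i); move: (rev_ord (rev_ord i)) => _ ->.
have [g' g'E] : hyp_function (fun h' => hyp_poly_at g (pull h')).
  have H := @hyp_function_algebra F n _ b'.
  apply: (falg_hyp_poly H) => i j.
  apply: (falg_mx_mul H); last exact: (falg_mx_cst H).
  apply: (falg_mx_mul H); first exact: (falg_mx_cst H).
  exact: hyp_function_mx.
exists g'; split.
  pose h1 : hyperplanes F n b' := fun i j => (Y i (rev_ord i))^T *m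
    h0 (rev_ord i) (cast_ord (bE i) j) *m Y i (rev_ord i).
  exists h1.
    by move=> i j; rewrite !trmx_mul trmxK h0s mulmxA.
  rewrite g'E; suff -> : pull h1 = h0 by [].
  apply: functional_extensionality_dep => i; apply/funext=> j; rewrite /pull /h1.
  have : val (cast_ord (bE _) (cast_ord (bE' i) j)) = val j by [].
  move: (rev_ordK i) (cast_ord (bE _) (cast_ord (bE' i) j)).
  move: (rev_ord (rev_ord i)) => _ -> j' /val_inj ->.
  by rewrite !mulmxA -trmx_mul YZ_rev trmx1 mul1mx -mulmxA YZ_rev mulmx1.
move=> h' h's; rewrite g'E => /(gX _ (pull_sym _ h's)) [s [sX s_inj s_surj]].
exists (fun a => sigma (s a)); split=> [a|a c /same_point_dual sac|y [Xy yh]].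
- by have [Xa /on_pull ah] := sX a; split=> //; apply: Xs.
- by apply: s_inj; rewrite -[s a]dual_familyK -[s c]dual_familyK; apply: sac.
have [|a ya] := s_surj (tau y).
  by split; [apply: Xt|apply/on_pull; rewrite dual_familyVK].
by exists a; rewrite -[y]dual_familyVK; apply: same_point_dual.
Qed.

End Congruence.

Theorem general_count_rev n (L : {vspace 'M[F]_n}) G (b b' : 'I_n.-1 -> nat) :
  (0 < n)%N -> (forall M, M \in L -> M^T = M) -> G \in L -> G \in unitmx ->
  (forall M, M \in L -> M \in unitmx -> G *m invmx M *m G \in L) ->
  (forall i, b' i = b (rev_ord i)) ->
  general_count b (X_ (k := n.-1) L) = general_count b' (X_ (k := n.-1) L).
Proof.
move=> n0 Ls GL uG Linv bE; set k := n.-1 in b b' bE *.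
(* Composing the matrix [Q] of [compound_dual] with the compound of [G] realizes M |-> G M^-1 G
   linearly, from the factor of [j] to that of [i]. The pair [(0, 0)] is a default for sizes that
   are not complementary. *)
have dual (i j : 'I_k) : exists ZY : 'M[F]_(#|wedge_index n i.+1|, #|wedge_index n j.+1|) *
      'M[F]_(#|wedge_index n j.+1|, #|wedge_index n i.+1|),
    (i.+1 + j.+1)%N = n -> [/\ ZY.1 *m ZY.2 = 1%:M, ZY.2 *m ZY.1 = 1%:M &
      forall M, M \in L -> M \in unitmx ->
        ZY.1 *m compound j.+1 M *m ZY.1^T =
        \det M *: compound i.+1 (G *m invmx M *m G)].
  have [ijn|nij] := eqVneq (i.+1 + j.+1)%N n; last first.
    by exists (0, 0) => ijn; rewrite ijn eqxx in nij.
  have [Q [Q1 Q2 QE]] := compound_dual F ijn.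
  have CG : compound i.+1 G *m compound i.+1 (invmx G) = 1%:M.
    by rewrite -compoundM mulmxV // compound1.
  exists (compound i.+1 G *m Q, Q^T *m compound i.+1 (invmx G)) => _ /=.
  split=> [||M ML uM].
  - by rewrite mulmxA -(mulmxA _ Q) Q1 mulmx1.
  - by rewrite mulmxA -(mulmxA Q^T) (mulmx1C CG) mulmx1.
  rewrite trmx_mul !mulmxA -(mulmxA _ Q) -(mulmxA _ (Q *m _)) QE //.
  rewrite trmx_compound trmx_inv Ls // trmx_compound Ls //.
  by rewrite -scalemxAr -scalemxAl !compoundM.
have revE (i : 'I_k) : (i.+1 + (rev_ord i).+1)%N = n.
  by rewrite /= -(prednK n0) -/k; have := ltn_ord i; lia.
have /fin_all_exists [ZY ZYP] (i : 'I_k) := fin_all_exists (dual i).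
pose Z i j := (ZY i j).1; pose Y i j := (ZY i j).2.
have ZYE i : Z i (rev_ord i) *m Y i (rev_ord i) = 1%:M.
  by have [] := ZYP _ _ (revE i).
have YZE i : Y i (rev_ord i) *m Z i (rev_ord i) = 1%:M.
  by have [] := ZYP _ _ (revE i).
have ZE i M : M \in L -> M \in unitmx ->
    Z i (rev_ord i) *m compound (rev_ord i).+1 M *m (Z i (rev_ord i))^T =
    \det M *: compound i.+1 (G *m invmx M *m G).
  by move=> ML uM; have [_ _] := ZYP _ _ (revE i); apply.
have dL M : M \in L -> M \in unitmx ->
    exists2 N, [/\ N \in L, N \in unitmx & G *m invmx N *m G = M] &
      G *m invmx M *m G = N.
  move=> ML uM; have uN : G *m invmx M *m G \in unitmx.
    by rewrite !unitmx_mul unitmx_inv uG uM.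
  exists (G *m invmx M *m G) => //; split=> //; first exact: Linv.
  have -> : invmx (G *m invmx M *m G) = invmx G *m M *m invmx G.
    rewrite -[LHS]mulmx1; apply: (canLR (mulKmx uN)).
    by rewrite !mulmxA mulmxK // mulmxKV // mulmxV.
  by rewrite !mulmxA mulmxV // mul1mx mulmxKV.
have XZ x : X_ L x -> X_ L (dual_family (fun i => Z i (rev_ord i)) x).
  apply: (dual_family_X (B := fun i => Y i (rev_ord i)) GL uG n0 (leq_pred n) YZE).
  move=> M ML uM; have [N [NL uN _] NE] := dL M ML uM.
  exists N, (fun=> \det M); split=> // i.
  by rewrite /dual_family ZE // NE.
have XY x : X_ L x -> X_ L (dual_family (fun i => Y (rev_ord i) i) x).
  apply: (dual_family_X (B := fun i => Z (rev_ord i) i) GL uG n0 (leq_pred n)).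
    by move=> i; apply: ZY_rev.
  (* The inversion is an involution, so [M] is itself the image of [N], and applying [Y] undoes [Z]
     at [N]. *)
  move=> M ML uM; have [N [NL uN NM] NE] := dL M ML uM.
  exists N, (fun=> (\det N)^-1); split=> // i.
  rewrite /dual_family -NM; move: (ZE (rev_ord i) N NL uN).
  have YZi := YZ_rev YZE i; move: (rev_ordK i).
  move: (rev_ord (rev_ord i)) => _ -> NE'.
  have -> : compound (rev_ord i).+1 (G *m invmx N *m G) = (\det N)^-1 *:
      (Z (rev_ord i) i *m compound i.+1 N *m (Z (rev_ord i) i)^T).
    by rewrite NE' scalerA mulVf ?scale1r // -unitfE -[_ \is a _]unitmxE.
  rewrite -scalemxAr -scalemxAl; congr (_ *: _).
  by rewrite !mulmxA YZi mul1mx -mulmxA -trmx_mul YZi trmx1 mulmx1.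
have count_dual c c' N : (forall i, c' i = c (rev_ord i)) ->
    is_general_count c (X_ (k := k) L) N -> is_general_count c' (X_ (k := k) L) N.
  exact: (is_general_count_dual ZYE YZE XZ XY).
(* Both counts are chosen from the same set of integers, so no value has to be exhibited. *)
rewrite /general_count; congr (classical_sets.xget _ _).
apply/funext=> N; apply/propext; split; apply: count_dual => // i.
by rewrite bE rev_ordK.
Qed.

End Duality.

(** * Counting over the last factor *)

Section Quadrics.
Variable F : fieldType.

(* Among the monomials of degree [m.+1] in [m] variables, written as words, each
   contains a square; replacing it by the corresponding quadric gives a square
   linear system in the monomials, which is the identity for the quadrics
   [x_i ^ 2]. *)
Lemma quadrics_resultant m : exists D : ('I_m -> 'M[F]_m) -> F,
  [/\ forall (T : Type) (P : (T -> F) -> Prop) (Q : T -> 'I_m -> 'M[F]_m),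
        function_algebra P -> (forall i, falg_mx P (fun x => Q x i)) ->
        P (fun x => D (Q x)),
      D (fun i => delta_mx i i) != 0
    & forall Q, D Q != 0 -> forall v : 'rV[F]_m,
        (forall i, v *m Q i *m v^T = 0) -> v = 0].
Proof.
pose W := {ffun 'I_m.+1 -> 'I_m}.
have /fin_all_exists [p /fin_all_exists [q pq]] (f : W) :
    exists i j, i != j /\ f i = f j.
  have /injectivePn [i [j ij fij]] : ~~ injectiveb f.
    by apply/injectiveP => /leq_card; rewrite !card_ord ltnn.
  by exists i, j.
pose sub (f : W) a b : W :=
  [ffun x => if x == p f then a else if x == q f then b else f x].
pose S (Q : 'I_m -> 'M[F]_m) : 'M[F]_#|W| := \matrix_(u, w)
  \sum_a \sum_b (sub (enum_val u) a b == enum_val w)%:R *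
     Q (enum_val u (p (enum_val u))) a b.
exists (fun Q => \det (S Q)); split.
- move=> T P Q algP PQ; apply: (falg_det algP) => u w.
  under eq_fun do rewrite mxE.
  apply: (falg_sum algP) => a; apply: (falg_sum algP) => b.
  by apply: (falg_mul algP); [exact: (falg_cst algP)|exact: PQ].
- suff -> : S (fun i => delta_mx i i) = 1%:M by rewrite det1 oner_neq0.
  apply/matrixP=> u w; rewrite !mxE; set f := enum_val u.
  rewrite (bigD1 (f (p f))) //= [X in _ + X]big1 ?addr0 => [|a na]; last first.
    by rewrite big1 // => b _; rewrite mxE (negPf na) mulr0.
  rewrite (bigD1 (f (p f))) //= [X in _ + X]big1 ?addr0 => [|b nb]; last first.
    by rewrite mxE (negPf nb) andbF mulr0.
  rewrite mxE !eqxx mulr1 -(inj_eq enum_val_inj) -/f; congr (_ == _)%:R.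
  apply/ffunP=> x; rewrite ffunE.
  have [-> //|_] := eqVneq x (p f).
  by have [->|//] := eqVneq x (q f); case: (pq f).
move=> Q detS v Qv; pose mon (f : W) := \prod_x v 0 (f x).
(* At a common zero [v] of the quadrics the vector of all monomials lies in the kernel of [S Q]. If
   [S Q] is invertible they all vanish, among them the powers of single coordinates. *)
have monS : S Q *m \col_w mon (enum_val w) = 0.
  apply/colP=> u; rewrite !mxE; set f := enum_val u.
  transitivity (\sum_a \sum_b Q (f (p f)) a b * mon (sub f a b)).
    under eq_bigr => w _ do rewrite !mxE big_distrl /=.
    rewrite exchange_big; apply: eq_bigr => a _ /=.
    under eq_bigr => w _ do rewrite big_distrl /=.
    rewrite exchange_big; apply: eq_bigr => b _ /=.
    rewrite (bigD1 (enum_rank (sub f a b))) //= big1 ?addr0 => [|w nw].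
      by rewrite enum_rankK eqxx mul1r.
    have [sw|_] := eqVneq; last by rewrite !mul0r.
    by rewrite sw enum_valK eqxx in nw.
  have [npq fpq] := pq f.
  have monE a b : mon (sub f a b) =
      v 0 a * v 0 b * \prod_(x | (x != p f) && (x != q f)) v 0 (f x).
    rewrite /mon (bigD1 (p f)) //= (bigD1 (q f)) /=; last by rewrite eq_sym.
    rewrite mulrA !ffunE !eqxx eq_sym (negPf npq); congr (_ * _).
    apply: eq_bigr => x /andP[xp xq].
    by rewrite ffunE (negPf xp) (negPf xq).
  have /matrixP/(_ 0 0) := Qv (f (p f)); rewrite !mxE => Qv0.
  rewrite exchange_big /=.
  transitivity ((\sum_b (v *m Q (f (p f))) 0 b * v^T b 0) *
    \prod_(x | (x != p f) && (x != q f)) v 0 (f x)); last by rewrite Qv0 mul0r.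
  rewrite big_distrl; apply: eq_bigr => b _ /=; rewrite !mxE !big_distrl /=.
  by apply: eq_bigr => a _; rewrite monE; ring.
have uS : S Q \in unitmx by rewrite unitmxE unitfE.
have mon0 f : mon f = 0.
  have := congr1 (mulmx (invmx (S Q))) monS; rewrite mulKmx // mulmx0.
  by move=> /colP/(_ (enum_rank f)); rewrite !mxE enum_rankK.
apply/rowP=> i; rewrite mxE; apply/eqP.
have := mon0 [ffun=> i]; rewrite /mon; under eq_bigr do rewrite ffunE.
by rewrite prodr_const => /eqP; rewrite expf_eq0 => /andP[].
Qed.

End Quadrics.

(** * Points over the last factor when all determinants vanish *)

Section LastFactor.
Variable F : numFieldType.

Lemma rank1_minor n (y : 'M[F]_n) s t s' t' : (\rank y <= 1)%N ->
  y s t * y s' t' = y s t' * y s' t.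
Proof.
have := mulmx_base y; move: (col_base y) (row_base y).
case: (\rank y) => [|[|//]] C R <- _; rewrite !mxE; first by rewrite !big_ord0.
by rewrite !big_ord1; ring.
Qed.

Lemma rank1_symmetric n (y : 'M[F]_n) : y^T = y -> y != 0 ->
  (forall s t s' t', y s t * y s' t' = y s t' * y s' t) ->
  exists c (u : 'rV[F]_n), y = c *: (u^T *m u).
Proof.
move=> ysym /matrix0Pn [s [t yst]] ry.
have yC a b : y a b = y b a by rewrite -[in LHS]ysym mxE.
have yss : y s s != 0.
  (* By symmetry [y s t ^+ 2 = y s s * y t t], so a nonzero entry forces a nonzero diagonal
     entry. *)
  have := ry s t t s; rewrite [y t s]yC => e.
  have : y s t * y s t != 0 by rewrite mulf_neq0.
  by rewrite e mulf_eq0 negb_or => /andP[].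
exists (y s s)^-1, (row s y); apply/matrixP=> a b.
rewrite !mxE big_ord1 !mxE; apply: (canRL (mulKf yss)).
by rewrite mulrC (ry a b s s) (yC a s).
Qed.

(** Along K = M + t N one has [\adj K *m K = 0]. Multiplying by [\adj M] on the right kills the term
    in M and leaves t times [\adj K *m N *m \adj M]; cancel t and specialize to t = 0. *)
Lemma adj_sandwich n (L : {vspace 'M[F]_n}) M N :
  (forall K, K \in L -> \det K = 0) -> M \in L -> N \in L ->
  \adj M *m N *m \adj M = 0.
Proof.
move=> L0 ML NL; apply/matrixP=> a c; rewrite [RHS]mxE.
have U := univariate_algebra F.
suff /(_ 0) : forall t, (\adj (M + t *: N) *m N *m \adj M) a c = 0.
  by rewrite scale0r addr0.
apply: (univariate_eq0 (g := id)); [|exact: univariate_id|by exists 1; rewrite oner_neq0|].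
  apply: (falg_mx_mul U); last exact: (falg_mx_cst U).
  apply: (falg_mx_mul U); last exact: (falg_mx_cst U).
  apply: (falg_adj U); apply: (falg_mx_add U); first exact: (falg_mx_cst U).
  by apply: (falg_mx_scale U); [exact: univariate_id|exact: (falg_mx_cst U)].
move=> t t0; have : \adj (M + t *: N) *m (M + t *: N) *m \adj M = 0.
  by rewrite mul_adj_mx L0 ?memvD ?memvZ // raddf0 mul0mx.
rewrite mulmxDr mulmxDl -mulmxA mul_mx_adj L0 // raddf0 mulmx0 add0r.
rewrite -scalemxAr -scalemxAl => /eqP.
by rewrite scaler_eq0 (negPf t0) => /eqP->; rewrite mxE.
Qed.

Lemma X_last m (L : {vspace 'M[F]_m.+2}) Q (x : factor_family F m.+2 m.+1) :
  (forall M, M \in L -> M^T = M) -> (forall M, M \in L -> \det M = 0) ->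
  Q^T *m Q = 1%:M ->
  (forall M, Q *m compound m.+1 M *m Q^T = (\adj M)^T) ->
  X_ L x ->
  (forall s t s' t',
     x ord_max s t * x ord_max s' t' = x ord_max s t' * x ord_max s' t) /\
  (forall M, M \in L ->
     let z := Q *m (x ord_max : 'M_#|wedge_index m.+2 m.+1|) *m Q^T in
     z *m M *m z = 0).
Proof.
move=> Ls L0 Q2 QE Xx.
have QK (y : 'M_#|wedge_index m.+2 m.+1|) : Q^T *m (Q *m y *m Q^T) *m Q = y.
  by rewrite !mulmxA Q2 mul1mx -mulmxA Q2 mulmx1.
split=> [s t s' t'|M ML z].
  apply/eqP; rewrite -subr_eq0; apply/eqP.
  have df := has_degreeB
    (has_degreeM (has_degree_coord F (i := ord_max) s t) (has_degree_coord F s' t'))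
    (has_degreeM (has_degree_coord F (i := ord_max) s t') (has_degree_coord F s' t)).
  apply: (zariski_closure_vanish Xx df) => y [M [ML M0 rM yE]].
  apply/eqP; rewrite subr_eq0 yE; apply/eqP; apply: rank1_minor.
  rewrite -[compound _ _]QK QE.
  rewrite (leq_trans (mxrankM_maxl _ _)) // (leq_trans (mxrankM_maxr _ _)) //.
  rewrite mxrank_tr.
  (* [\adj M *m M = 0] and [M] has rank at least [m.+1], so the adjugate has rank at most 1. *)
  have : (\rank (\adj M) + \rank M <= m.+2)%N.
    by apply: mulmx0_rank_max; rewrite mul_adj_mx L0 // raddf0.
  by move=> rS; rewrite -(leq_add2r m.+1) (leq_trans _ rS) // leq_add2l.
pose zx (x : factor_family F m.+2 m.+1) :=
  Q *m (x ord_max : 'M_#|wedge_index m.+2 m.+1|) *m Q^T.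
have dz a c : has_degree (fun j => (ord_max == j) : nat) (fun x => zx x a c).
  apply: has_degree_eq (_ : has_degree _ (fun x : factor_family F m.+2 m.+1 =>
     \sum_u \sum_v (Q a v * Q^T u c) * x ord_max v u)) => // [y|].
    rewrite !mxE; apply: eq_bigr => u _; rewrite !mxE big_distrl /=.
    by apply: eq_bigr => v _; rewrite mulrAC.
  do 2!apply: has_degree_sum => ? _.
  by apply: has_degreeZ; apply: has_degree_coord.
apply/matrixP=> a c; rewrite [RHS]mxE -/(zx x).
have df : has_degree (fun j => (ord_max == j) + (ord_max == j))%N
    (fun x => (zx x *m M *m zx x) a c).
  apply: has_degree_eq (_ : has_degree _ (fun x : factor_family F m.+2 m.+1 =>
     \sum_u \sum_v M v u * (zx x a v * zx x u c))) => // [y|].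
    rewrite !mxE; apply: eq_bigr => u _; rewrite !mxE big_distrl /=.
    by apply: eq_bigr => v _; ring.
  do 2!apply: has_degree_sum => ? _.
  by apply: has_degreeZ; apply: has_degreeM.
apply: (zariski_closure_vanish Xx df) => y [N [NL N0 rN yE]].
rewrite /zx yE QE trmx_adj Ls //.
by rewrite (adj_sandwich L0) // mxE.
Qed.

(** The last coordinate is a multiple of a square of a vector isotropic for [L], hence of a vector
    in the kernel of [tau]. On that kernel the [b ord_max] hyperplanes become as many quadrics as
    there are variables, and a nonzero resultant leaves only the origin. *)
Lemma general_count_last m (L : {vspace 'M[F]_m.+2}) (tau : 'cV[F]_m.+2)
    (b : 'I_m.+1 -> nat) :
  (forall M, M \in L -> M^T = M) -> (forall M, M \in L -> \det M = 0) ->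
  tau != 0 ->
  (forall v : 'rV_m.+2, (forall M, M \in L -> v *m M *m v^T = 0) -> v *m tau = 0) ->
  b ord_max = m.+1 ->
  is_general_count b (X_ (k := m.+1) L) 0.
Proof.
move=> Ls L0 tau0 Ltau bE; have [Q [Q1 Q2 QE]] := compound_last F m.+1.
set B := row_base (kermx tau); set r := \rank (kermx tau) in B.
have rE : r = b ord_max.
  have r1 : \rank tau = 1%N.
    by apply/eqP; rewrite eqn_leq rank_leq_col lt0n mxrank_eq0.
  by rewrite bE /r mxrank_ker r1.
have [D [Dalg D1 D0]] := quadrics_resultant F r.
(* The quadratic form that a hyperplane induces on the kernel of [tau], in the basis [B]. *)
pose q (h : hyperplanes F m.+2 b) (i : 'I_r) := B *m Q *m
  (h ord_max (cast_ord rE i) : 'M_#|wedge_index m.+2 m.+1|) *m Q^T *m B^T.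
have [g gE] : hyp_function (fun h => D (q h)).
  have H := @hyp_function_algebra F m.+2 _ b.
  apply: (Dalg _ _ _ H) => i.
  do 2!(apply: (falg_mx_mul H); last exact: (falg_mx_cst H)).
  apply: (falg_mx_mul H); first exact: (falg_mx_cst H).
  exact: (@hyp_function_mx F m.+2 _ b ord_max (cast_ord rE i)).
exists g; split.
  (* A right inverse of [B] lifts the quadrics [x_i ^ 2] to hyperplanes; at these the resultant is
     nonzero. *)
  have [C BC] : exists C, B *m C = 1%:M.
    by exists (pinvmx B); rewrite mulmxVp ?row_base_free.
  pose v (j : 'I_(b ord_max)) : 'M[F]_#|wedge_index m.+2 m.+1| :=
    Q^T *m (C *m delta_mx (cast_ord (esym rE) j) (cast_ord (esym rE) j) *m C^T) *m Q.
  pose h : hyperplanes F m.+2 b :=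
    @dfwith _ (fun i => 'I_(b i) -> 'M[F]_#|wedge_index m.+2 i.+1|)
      (fun i _ => 0) ord_max v.
  have hE : h ord_max = v by rewrite /h dfwith_in.
  exists h.
    move=> i; have [->|i0] := eqVneq i ord_max => j.
      by rewrite hE /v !trmx_mul !trmxK trmx_delta !mulmxA.
    by rewrite /h dfwith_out 1?eq_sym // trmx0.
  rewrite gE; suff -> : q h = fun i => delta_mx i i by [].
  apply/funext=> i; rewrite /q hE /v cast_ordK.
  rewrite !mulmxA -(mulmxA B) Q1 mulmx1 BC mul1mx.
  by rewrite -(mulmxA _ Q) Q1 mulmx1 -mulmxA -trmx_mul BC trmx1 mulmx1.
move=> h hs; rewrite gE => Dh.
suff noX x : X_ L x -> ~ on_hyperplanes h x.
  exists (fun a : 'I_0 => fun i => 0); split=> [[]|[]|x [Xx /(noX _ Xx)]] //.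
move=> Xx hx; have [ys y0] := Xx.1 ord_max.
have [/(rank1_symmetric ys y0) [c [u yE]] zMz] := X_last Ls L0 Q2 QE Xx.
move: y0 yE zMz; set y := x ord_max => y0 yE zMz.
have [z zdef] : exists z, z = Q *m (y : 'M_#|wedge_index m.+2 m.+1|) *m Q^T.
  by eexists.
have [v [zE uE]] : exists v : 'rV_m.+2, z = c *: (v^T *m v) /\ u = v *m Q.
  exists (u *m Q^T); rewrite zdef yE -scalemxAr -scalemxAl trmx_mul trmxK.
  by rewrite !mulmxA -(mulmxA u) Q2 mulmx1.
have z0 : z != 0.
  apply: contraNneq y0 => z0; have := congr1 (fun z => Q^T *m z *m Q) zdef.
  by rewrite z0 mulmx0 mul0mx !mulmxA Q2 mul1mx -mulmxA Q2 mulmx1 => <-.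
have c0 : c != 0 by apply: contraNneq z0 => c0; rewrite zE c0 scale0r.
have vMv M : M \in L -> v *m M *m v^T = 0.
  move=> ML; have := zMz M ML; rewrite /= -zdef [in X in _ *m X]zE [in X in X *m _]zE.
  have -> : c *: (v^T *m v) *m M *m (c *: (v^T *m v)) =
      (c * c) *: (v^T *m (v *m M *m v^T) *m v).
    by rewrite -!scalemxAr -!scalemxAl scalerA !mulmxA.
  (* With [a] the value of the form at [v], the product [z *m M *m z] is [c * a] times [z], so its
     vanishing gives [a = 0]. *)
  rewrite [v *m M *m v^T]mx11_scalar; set a := (v *m M *m v^T) 0 0.
  rewrite mul_mx_scalar -scalemxAl scalerA mulrAC -scalerA -zE.
  move=> /eqP; rewrite scaler_eq0 mulf_eq0 (negPf z0) (negPf c0) orbF /= => /eqP ->.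
  by rewrite raddf0.
have /submxP [w vE] : (v <= B)%MS.
  by rewrite eq_row_base; apply/sub_kermxP/Ltau.
have w0 : w = 0.
  apply: (D0 _ Dh) => i; rewrite /q.
  have := hx ord_max (cast_ord rE i); set hi := h _ _; rewrite -/y yE.
  rewrite -scalemxAr mxtraceZ (mulmxA hi) (mxtrace_mulC (hi *m _)) mulmxA => /eqP.
  rewrite mulf_eq0 (negPf c0) /= => /eqP tr0.
  apply/matrixP=> j l; rewrite !ord1 [RHS]mxE -[RHS]tr0 trace_mx11 uE vE.
  by rewrite !trmx_mul !mulmxA.
case/eqP: z0; rewrite zE vE w0 mul0mx mulmx0 scaler0 //.
Qed.

End LastFactor.

(** * Forms on an algebra *)

Section AlgebraForms.
Variables (F : fieldType) (A : falgType F).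
Hypothesis mulA_comm : commutative (@GRing.mul A).
Variables (n : nat) (e : n.-tuple A).
Hypothesis basis_e : basis_of {:A} e.
Implicit Types (l : 'Hom(A, F^o)) (v : 'rV[F]_n).

Definition vec v : A := \sum_i v 0 i *: tnth e i.

Lemma tnth_e i : tnth e i = e`_i. Proof. by rewrite (tnth_nth 0). Qed.

Lemma vec_coord a : vec (\row_i coord e i a) = a.
Proof.
rewrite [RHS](coord_basis basis_e (memvf a)).
by apply: eq_bigr => i _; rewrite mxE tnth_e.
Qed.

Lemma vec_inj : injective vec.
Proof.
move=> v w vw; apply/rowP=> i.
have E (u : 'rV[F]_n) : u 0 i = coord e i (vec u).
  under [vec u]eq_bigr do rewrite tnth_e.
  by rewrite coord_sum_free ?(basis_free basis_e).
by rewrite !E vw.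
Qed.

Lemma vec0 : vec 0 = 0.
Proof. by rewrite /vec big1 // => i _; rewrite mxE scale0r. Qed.

Lemma form_mx_sym l : (form_mx e l)^T = form_mx e l.
Proof. by apply/matrixP=> i j; rewrite !mxE mulA_comm. Qed.

Lemma form_mx_row l v j : (v *m form_mx e l) 0 j = l (vec v * tnth e j).
Proof.
rewrite mxE mulr_suml linear_sum; apply: eq_bigr => i _.
by rewrite mxE -scalerAl linearZ.
Qed.

Lemma form_mxE l v w : (v *m form_mx e l *m w^T) 0 0 = l (vec v * vec w).
Proof.
rewrite mxE [vec w]/vec mulr_sumr linear_sum; apply: eq_bigr => j _.
by rewrite form_mx_row mxE -scalerAr linearZ mulrC.
Qed.

Lemma form_mx_unit_solve l (f : 'Hom(A, F^o)) : form_mx e l \in unitmx ->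
  exists! a, forall b, l (a * b) = f b.
Proof.
move=> ul; pose v := \row_j f (tnth e j) *m invmx (form_mx e l).
exists (vec v); split=> [b|a aE].
  rewrite -(vec_coord b) -form_mxE /v mulmxKV // mxE linear_sum.
  by apply: eq_bigr => j _; rewrite !mxE linearZ mulrC.
rewrite -(vec_coord a); congr vec; rewrite /v.
apply: (canLR (mulmxK ul)); apply/rowP=> j.
by rewrite form_mx_row vec_coord aE mxE.
Qed.

Lemma Gorenstein_unit : Gorenstein A <-> exists l, form_mx e l \in unitmx.
Proof.
split=> [[l [pairing _]]|[l ul]]; exists l; last first.
  split=> f; first exact: form_mx_unit_solve.
  have [a [aE au]] := form_mx_unit_solve f ul.
  exists a; split=> [b|a' a'E]; first by rewrite mulA_comm.
  by apply: au => b; rewrite mulA_comm.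
rewrite -row_free_unit -kermx_eq0; apply/eqP/row_matrixP => i; rewrite row0.
apply: vec_inj; rewrite vec0; set v := row i _.
have vl : v *m form_mx e l = 0.
  by apply/sub_kermxP; apply: row_sub.
have [a [_ au]] := pairing 0.
rewrite -(au 0) => [|b]; last by rewrite mul0r linear0 lfunE.
apply/esym/au => b; rewrite -(vec_coord b) -form_mxE vl mul0mx mxE.
by rewrite lfunE.
Qed.

Lemma form_space_sym M : M \in form_space e -> M^T = M.
Proof. by move=> /form_spaceP [l ->]; apply: form_mx_sym. Qed.

Lemma Gorenstein_form_space :
  Gorenstein A <-> exists2 M, M \in form_space e & M \in unitmx.
Proof.
rewrite Gorenstein_unit; split=> [[l ul]|[_ /form_spaceP[l ->] ul]]; last by exists l.
by exists (form_mx e l) => //; apply/form_spaceP; exists l.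
Qed.

Lemma dim_form_space : \dim (form_space e) = n.
Proof.
have k0 : (fullv :&: lker (linfun (form_mx e)) = 0)%VS.
  apply/eqP; rewrite capfv -subv0; apply/subvP => l.
  rewrite memv_ker lfunE memv0 => /eqP l0; apply/eqP/lfunP => a.
  (* The form determines [l], since [l a] is its value at [(a, 1)]. *)
  rewrite -[a]mulr1 -(vec_coord 1) -(vec_coord a) -form_mxE l0.
  by rewrite mulmx0 mul0mx mxE lfunE.
by rewrite /form_space limg_dim_eq // dimvf /dim /= muln1 -dimvf (vector.size_basis basis_e).
Qed.

Definition reg_mx (a : A) : 'M[F]_n := \matrix_(i, j) coord e j (tnth e i * a).

Lemma reg_mxE a i : tnth e i * a = \sum_j reg_mx a i j *: tnth e j.
Proof.
rewrite [LHS](coord_basis basis_e (memvf _)).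
by apply: eq_bigr => j _; rewrite mxE !tnth_e.
Qed.

Lemma reg_mxM a b : reg_mx (a * b) = reg_mx a *m reg_mx b.
Proof.
apply/matrixP=> i k; rewrite !mxE mulrA reg_mxE mulr_suml linear_sum.
by apply: eq_bigr => j _; rewrite -scalerAl linearZ /= [reg_mx b _ _]mxE.
Qed.

Lemma reg_mx1 : reg_mx 1 = 1%:M.
Proof.
apply/matrixP=> i j; rewrite !mxE mulr1 tnth_e.
by rewrite coord_free ?(basis_free basis_e) // eq_sym.
Qed.

Lemma reg_mx_form l c : reg_mx c *m form_mx e l = form_mx e (l \o amull c)%VF.
Proof.
apply/matrixP=> i k; rewrite !mxE comp_lfunE lfunE /= mulrA (mulA_comm c) reg_mxE.
rewrite mulr_suml linear_sum; apply: eq_bigr => j _.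
by rewrite [form_mx _ _ _ _]mxE -scalerAl linearZ.
Qed.

(** The invertible form of [l] represents [l0] as b |-> l(c b), so [G] is [reg_mx c] times the form
    of [l]. Cancelling leaves [reg_mx (c * c)] times that form, which is again a form on the
    algebra. *)
Lemma form_space_inversion G M : G \in form_space e -> M \in form_space e ->
  M \in unitmx -> G *m invmx M *m G \in form_space e.
Proof.
move=> /form_spaceP[l0 ->] /form_spaceP[l ->] ul.
have [c [cE _]] := form_mx_unit_solve l0 ul.
have -> : form_mx e l0 = reg_mx c *m form_mx e l.
  rewrite reg_mx_form; congr form_mx; apply/lfunP => b.
  by rewrite comp_lfunE lfunE /= cE.
rewrite mulmxK // mulmxA -reg_mxM reg_mx_form.
by apply/form_spaceP; eexists.
Qed.

(** In a full rank factorization T = C R, the equation T T = 0 cancels to R C = 0, and T and R C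
    have the same trace. *)
Lemma trace_sqr0 (T : 'M[F]_n) : T *m T = 0 -> \tr T = 0.
Proof.
move=> TT; have RC : row_base T *m col_base T = 0.
  apply: (row_full_inj (col_base_full T)); apply: (row_free_inj (row_base_free T)).
  by rewrite mulmx0 mul0mx mulmxA mulmx_base -mulmxA mulmx_base.
by rewrite -(mulmx_base T) mxtrace_mulC RC mxtrace0.
Qed.

Definition trace_col : 'cV[F]_n := \col_i \tr (reg_mx (tnth e i)).

Lemma trace_colE v : (v *m trace_col) 0 0 = \tr (reg_mx (vec v)).
Proof.
rewrite mxE; under eq_bigr do rewrite mxE mulr_sumr.
rewrite exchange_big; apply: eq_bigr => k _; rewrite mxE mulr_sumr linear_sum.
by apply: eq_bigr => i _; rewrite mxE -scalerAr linearZ.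
Qed.

(* An isotropic vector has square zero in [A], so multiplication by it has trace
   zero. *)
Lemma isotropic_trace v : (forall M, M \in form_space e -> v *m M *m v^T = 0) ->
  v *m trace_col = 0.
Proof.
move=> vL; have vv : vec v * vec v = 0.
  apply/eqP; rewrite -memv0; apply: memv_annihilated => l _.
  by rewrite -form_mxE vL ?mxE //; apply/form_spaceP; exists l.
apply/matrixP=> i j; rewrite !ord1 trace_colE mxE trace_sqr0 // -reg_mxM vv.
by apply/matrixP=> s t; rewrite !mxE mulr0 linear0.
Qed.

End AlgebraForms.

(** * Characteristic numbers of the space of forms *)

Section CharacteristicNumbers.
Variable F : numFieldType.

Lemma max_rankP n (L : {vspace 'M[F]_n}) :
  (exists2 M, M \in L & \rank M = max_rank L) /\
  (forall M, M \in L -> (\rank M <= max_rank L)%N).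
Proof.
have le M : M \in L -> (\rank M <= max_rank L)%N.
  move=> ML; have rn : (\rank M < n.+1)%N by rewrite ltnS rank_leq_row.
  apply: (leq_bigmax_cond (Ordinal rn)) => /=.
  by apply/asboolP; exists M.
split=> //; rewrite /max_rank.
have [|r] := eq_bigmax_cond (A := fun r : 'I_n.+1 =>
    `[< exists2 M, M \in L & \rank M = r >]) (fun r => r : nat).
  apply/card_gt0P; exists ord0; apply/asboolP; exists 0; rewrite ?mem0v //.
  by rewrite mxrank0.
by move=> /asboolP[M ML rM] ->; exists M.
Qed.

Variables (A : falgType F) (mulA_comm : commutative (@GRing.mul A)).

Section Dimension.
Variables (m : nat) (e : m.+2.-tuple A) (basis_e : basis_of {:A} e).
Let L := form_space e.

Lemma char_number_first : char_number L (end_exponents m.+1 0) = 1%N.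
Proof.
have [[Ms MsL rMs] rL] := max_rankP L.
(* [L] is nonzero, so at least one factor is in use even when all forms have small rank. *)
have [k kE] : exists k, nb_factors L = k.+1.
  case E: (nb_factors L) => [|k]; last by exists k.
  move: E; rewrite /nb_factors /minn; case: ifP => // _ L0.
  have /subvP := sub0v L; have : \dim L != 0 by rewrite dim_form_space.
  rewrite dimv_eq0 => /eqP[]; apply/eqP; rewrite -subv0; apply/subvP => M /rL.
  by rewrite L0 leqn0 mxrank_eq0 memv0.
have kn : (k.+1 <= m.+2.-1)%N by rewrite -kE geq_minr.
rewrite (char_numberE kn kE) => [|j jk]; last first.
  by rewrite /end_exponents if_same addn0; case: j jk => [[]].
apply: general_countE; apply: general_count_first.
- exact: form_space_sym.
- by rewrite dim_form_space // /end_exponents /= if_same addn0.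
- move=> i i0; rewrite /end_exponents /= if_same addn0.
  by rewrite -(inj_eq val_inj) in i0; rewrite (negPf i0).
by exists Ms; rewrite // rMs -kE geq_minl.
Qed.

Lemma char_number_last : ~ Gorenstein A -> char_number L (end_exponents 0 m.+1) = 0%N.
Proof.
move=> nG; have L0 M : M \in L -> \det M = 0.
  move=> ML; apply/eqP; apply: contraT; rewrite -unitfE -[_ \is a _]unitmxE => uM.
  by case: nG; apply/(Gorenstein_form_space mulA_comm basis_e); exists M.
(* If no form reaches rank [m.+1], the number is zero by convention, as the exponent at [ord_max] is
   positive. *)
have [kE|kn] := eqVneq (nb_factors L) m.+1; last first.
  rewrite /char_number ifF //; apply/negbTE/forallPn; exists ord_max.
  rewrite negb_imply /end_exponents eqxx addn_eq0 andbF andbT.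
  by rewrite -ltnS ltn_neqAle kn geq_minr.
rewrite (char_numberE (n := m.+2) (leqnn m.+1) kE) => [|j]; last by rewrite leqNgt ltn_ord.
apply: general_countE; apply: (general_count_last (tau := trace_col e)) => //.
- exact: form_space_sym.
(* The regular trace of 1 is the dimension, nonzero in characteristic 0. *)
- apply/eqP => tau0; have := trace_colE e (\row_i coord e i 1).
  rewrite tau0 mulmx0 mxE vec_coord // reg_mx1 // mxtrace1 => /eqP.
  by rewrite eq_sym pnatr_eq0.
- by move=> v; apply: isotropic_trace.
- by rewrite /end_exponents /= eqxx if_same.
Qed.

Lemma Gorenstein_symmetric : Gorenstein A -> symmetric_char_seq L.
Proof.
move=> /(Gorenstein_form_space mulA_comm basis_e)[G GL uG].
have kE : nb_factors L = m.+1.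
  have := (max_rankP L).2 G GL; rewrite mxrank_unit // => rL.
  by apply/eqP; rewrite eqn_leq geq_minr leq_min leqnn andbT ltnW.
move=> i; rewrite /char_seq dim_form_space //= => im.
have jE (j : 'I_m.+2.-1) : (m.+1 <= j)%N -> false by rewrite leqNgt ltn_ord.
rewrite !(char_numberE (n := m.+2) (leqnn m.+1) kE); try by move=> j /jE.
apply: (general_count_rev (n := m.+2) (G := G)) => //.
- exact: form_space_sym.
- by move=> M ML uM; apply: form_space_inversion.
move=> j; have jm : (j <= m)%N by exact: (ltn_ord j).
rewrite /end_exponents /= subKn // addnC; congr (_ + _)%N.
  by rewrite (_ : (j.+2 == m.+2) = ((m.+1 - j.+1)%N == 0%N)) //; apply/eqP/eqP; lia.
by rewrite (_ : ((m.+1 - j.+1).+2 == m.+2) = (j == 0%N :> nat)) //; apply/eqP/eqP; lia.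
Qed.

End Dimension.

Theorem Gorenstein_char_numbers n (e : n.-tuple A) : basis_of {:A} e ->
  [/\ Gorenstein A <-> symmetric_char_seq (form_space e),
      Gorenstein A <->
        char_number (form_space e) (end_exponents 0 n.-1) = 1%N
    & Gorenstein A <->
        char_number (form_space e) (end_exponents 0 n.-1) <> 0%N].
Proof.
case: n e => [|[|m]] e basis_e.
- have := vec_coord basis_e 1; rewrite /vec big_ord0 => /esym/eqP.
  by rewrite oner_eq0.
(* In dimension 1 a nonzero form is invertible, so [A] is Gorenstein. There are no factors, and the
   unique empty family is counted once. *)
- have [M ML M0] : exists2 M, M \in form_space e & M != 0.
    exists (vpick (form_space e)); first exact: memv_pick.
    by rewrite vpick0 -dimv_eq0 dim_form_space.
  have Gor : Gorenstein A.
    apply/(Gorenstein_form_space mulA_comm basis_e); exists M => //.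
    rewrite -row_free_unit /row_free eqn_leq rank_leq_row lt0n mxrank_eq0 //.
  have c1 : char_number (form_space e) (end_exponents 0 1.-1) = 1%N.
    have kE : nb_factors (form_space e) = 0%N by apply/eqP; rewrite -leqn0 geq_minr.
    rewrite (char_numberE (n := 1) (leqnn 0) kE) => [|[]//]; apply: general_countE.
    exists 1; split; first by exists (fun i _ => 0); [case|rewrite /hyp_poly_at meval1 oner_neq0].
    move=> h _ _; exists (fun _ i => compound i.+1 M); split=> [a|a b _|x _].
    + split; last by case.
      by apply: Phi_in_X => //; apply: form_space_sym ML.
    + by rewrite !ord1.
    + by exists ord0 => -[].
  split; split=> // _; last by rewrite c1.
  by move=> i; rewrite dim_form_space // leqn0 => /eqP->.
(* Symmetry at index 0 would equate the first term, which is 1, with the last. *)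
have first_last : char_number (form_space e) (end_exponents 0 m.+1) = 0%N ->
    ~ symmetric_char_seq (form_space e).
  move=> c0 /(_ 0%N (leq0n _)); rewrite /char_seq dim_form_space //= subn0 subnn.
  by rewrite c0 char_number_first.
have Gor1 : Gorenstein A -> char_number (form_space e) (end_exponents 0 m.+1) = 1%N.
  move=> /(Gorenstein_symmetric basis_e)/(_ 0%N (leq0n _)).
  by rewrite /char_seq dim_form_space //= subn0 subnn char_number_first.
have nGor0 : char_number (form_space e) (end_exponents 0 m.+1) <> 0%N -> Gorenstein A.
  by move=> c0; apply: contra_notP c0; apply: char_number_last.
split; split.
- exact: Gorenstein_symmetric.
- by move=> sym; apply: nGor0 => /first_last.
- exact: Gor1.
- by move=> c1; apply: nGor0; rewrite /= c1.
- by move=> /Gor1 /= ->.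
- exact: nGor0.
Qed.

End CharacteristicNumbers.

Theorem proposition1p1 (R : realType) (A : falgType R[i])
    (mulA_comm : commutative (@GRing.mul A))
    (n : nat) (dimA : \dim {:A} = n)
    (e : n.-tuple A) (basis_e : basis_of {:A} e) :
  [/\ Gorenstein A <-> symmetric_char_seq (form_space e),
      Gorenstein A <->
        char_number (form_space e) (end_exponents 0 n.-1) = 1%N
    & Gorenstein A <->
        char_number (form_space e) (end_exponents 0 n.-1) <> 0%N].
Proof. exact: Gorenstein_char_numbers. Qed.
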